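(* Let $d\ge 1$ and let $\vec e=(e_1,e_2,e_3,e_4)$ be integers with $2\le e_i\le d$ for all $i$ and $2d-2=\sum_{i=1}^4(e_i-1)$. Then the Hurwitz number is given by $$h(d,4,0,\vec e)=\min\{e_i(d+1-e_i)\}_{1\le i\le 4}.$$ We can also describe the Hurwitz factorizations in this case completely explicitly. Namely, when the indices are ordered so that $e_1\le e_2\le e_3\le e_4$, the possible Hurwitz factorizations $(\sigma_1,\sigma_2,\sigma_3,\sigma_4)$ are, up to equivalence, classified as follows. (i) If $\sigma_3\sigma_4$ is trivial or a single cycle, then $$\sigma_1=(d,d-1,\dots,e_3+e_4+1-k,\ \sigma^{-(d+2-k-e_1)}(\ell),\sigma^{-(d+3-k-e_1)}(\ell),\dots,\sigma^{-(e_3+e_4+1-2k)}(\ell)=\ell),$$ $$\sigma_2=(e_3+e_4+1-k,e_3+e_4+2-k,\dots,d-1,d,\ \ell,\sigma^{-1}(\ell),\dots,\sigma^{-(d+1-k-e_1)}(\ell)),$$ $$\sigma_3=(k,k-1,\dots,2,1,\ e_4+1,e_4+2,\dots,e_3+e_4-k),\qquad \sigma_4=(1,\dots,e_4),$$ where any $k$ with $e_3+e_4-d\le k\le e_3$ and $k\le d+1-e_2$ is allowed, $\sigma:=(k,k+1,\dots,e_3+e_4-k)=\sigma_3\sigma_4$, and for a given $k$, any $\ell$ with $k\le \ell\le e_3+e_4-k$ is allowed. (ii) If $\sigma_3\sigma_4$ is a product of two disjoint cycles, then $$\sigma_1=(m+e_1-1,m+e_1-2,\dots,m+1,m),$$ $$\sigma_2=(d,d-1,\dots,m+e_1,\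 m+d+k-e_3-e_4,m+d-1+k-e_3-e_4,\dots,k),$$ $$\sigma_3=(k,k-1,\dots,1,\ e_4+1,e_4+2,\dots,m+e_1-1,\ m,m-1,\dots,m+d+1+k-e_3-e_4,\ m+e_1,m+e_1+1,\dots,d),$$ $$\sigma_4=(1,\dots,e_4),$$ where any $k$ with $1\le k\le e_3+e_4-d-1$ and any $m$ with $e_4-e_1+1\le m\le d+1-e_1$ and $m\le e_4$ are allowed.
   Context: A Hurwitz factorization for $(d,4,0,\vec e)$ is a tuple $(\sigma_1,\sigma_2,\sigma_3,\sigma_4)$ of elements of the symmetric group $S_d$ on $\{1,\dots,d\}$ such that $\sigma_i$ is an $e_i$-cycle for each $i$, $\sigma_1\sigma_2\sigma_3\sigma_4=1$, and the $\sigma_i$ generate a transitive subgroup of $S_d$. Two Hurwitz factorizations are equivalent if they are related by simultaneous conjugation by an element of $S_d$. The Hurwitz number $h(d,4,0,\vec e)$ is the number of equivalence classes of Hurwitz factorizations for $(d,4,0,\vec e)$. Permutations are written in cycle notation and products are composed from right to left. Inside a cycle, an ascending or descending run of consecutive terms (including runs of consecutive powers of $\sigma$ applied to $\ell$) is allowed to be empty, i.e. to have length $0$. *)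

(* Defs.v *)
From mathcomp Require Import all_boot all_fingroup.

Set Implicit Arguments.
Unset Strict Implicit.
Unset Printing Implicit Defensive.

(* {1, ..., d} is encoded as 'I_d, the point x : 'I_d standing for x.+1. *)

(* The cycle (c_1, ..., c_n) of the entries of c, fixing every other point.
   [undup] only serves to make the definition total: for a list with distinct
   entries it is the identity. *)
Definition cycle_perm (T : finType) (c : seq T) : {perm T} :=
  perm (can_inj (prev_next (undup_uniq c))).

(* Right-to-left composition, x |-> s (t x); the product of {perm T} in
   MathComp composes from left to right. *)
Definition compp (T : finType) (s t : {perm T}) : {perm T} := (t * s)%g.

Definition is_cycle (T : finType) (n : nat) (s : {perm T}) : bool :=
  [exists c : n.-tuple T, uniq c && (s == cycle_perm c)].

Definition trivial_or_single_cycle (T : finType) (s : {perm T}) : Prop :=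
  s = 1%g \/ exists2 n, 2 <= n & is_cycle n s.

Definition two_disjoint_cycles (T : finType) (s : {perm T}) : Prop :=
  exists c1 c2 : seq T,
    [/\ 2 <= size c1, 2 <= size c2, uniq (c1 ++ c2)
      & s = compp (cycle_perm c1) (cycle_perm c2)].

(* The genus does not appear as a parameter: it is determined by d and e through
   the Riemann-Hurwitz formula 2 d - 2 + 2 g = \sum_i (e_i - 1). *)
Definition hurwitz_factorization (d r : nat) (e : r.-tuple nat)
    (s : r.-tuple 'S_d) : bool :=
  [&& [forall i, is_cycle (tnth e i) (tnth s i)],
      foldr (@compp 'I_d) 1%g s == 1%g
    & [transitive <<[set x in s]>>%g, on [set: 'I_d] | 'P]].

Definition hurwitz_equiv (d r : nat) (s t : r.-tuple 'S_d) : bool :=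
  [exists g : 'S_d, [forall i, tnth t i == (tnth s i ^ g)%g]].

Definition hurwitz_number (d r : nat) (e : r.-tuple nat) : nat :=
  #|equivalence_partition (@hurwitz_equiv d r)
      [set s | hurwitz_factorization e s]|.

(* The runs a, a+1, ..., b and a, a-1, ..., b of points of {1, ..., d}. *)
Definition asc (d a b : nat) : seq 'I_d :=
  [seq x : 'I_d <- enum 'I_d | a <= x.+1 <= b].
Definition desc (d a b : nat) : seq 'I_d := rev (asc d b a).

(* The run s^{-a}(l), s^{-(a+1)}(l), ..., s^{-b}(l). *)
Definition neg_powers (d : nat) (s : 'S_d) (l : 'I_d) (a b : nat) : seq 'I_d :=
  [seq (s ^- j)%g l | j <- index_iota a b.+1].

(* When 2 d + 2 = e1 + e2 + e3 + e4, e1 <= e2 <= e3 <= e4 <= d and the parameters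
   are admissible, none of the subtractions below is truncated. *)

Definition sigma (d e3 e4 k : nat) : 'S_d := cycle_perm (asc d k (e3 + e4 - k)).

Definition admissible_single (d e2 e3 e4 k : nat) (l : 'I_d) : bool :=
  [&& e3 + e4 - d <= k <= e3, k <= d + 1 - e2 & k <= l.+1 <= e3 + e4 - k].

Definition factorization_single (d e1 e3 e4 k : nat) (l : 'I_d) :
    4.-tuple 'S_d :=
  let sg := sigma d e3 e4 k in
  [tuple
     cycle_perm (desc d d (e3 + e4 + 1 - k)
       ++ neg_powers sg l (d + 2 - k - e1) (e3 + e4 + 1 - 2 * k));
     cycle_perm (asc d (e3 + e4 + 1 - k) d
       ++ neg_powers sg l 0 (d + 1 - k - e1));
     cycle_perm (desc d k 1 ++ asc d (e4 + 1) (e3 + e4 - k));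
     cycle_perm (asc d 1 e4)].

Definition admissible_double (d e1 e3 e4 k m : nat) : bool :=
  [&& 1 <= k <= e3 + e4 - d - 1, e4 - e1 + 1 <= m <= d + 1 - e1 & m <= e4].

Definition factorization_double (d e1 e3 e4 k m : nat) : 4.-tuple 'S_d :=
  [tuple
     cycle_perm (desc d (m + e1 - 1) m);
     cycle_perm (desc d d (m + e1) ++ desc d (m + d + k - e3 - e4) k);
     cycle_perm (desc d k 1 ++ asc d (e4 + 1) (m + e1 - 1)
       ++ desc d m (m + d + 1 + k - e3 - e4) ++ asc d (m + e1) d);
     cycle_perm (asc d 1 e4)].

(* Main.v *)
(* Let O be the union of the supports of s3 and s4, and O' that of s1 and s2.
   A point outside O' is fixed by s3 s4, hence lies in both supp s3 and supp s4,
   and s3 undoes s4 there; symmetrically outside O. Moreover every nonempty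
   subset of O stable under s3 s4 meets supp s3 and supp s4 simultaneously.
   Comparing |supp s3 /\ supp s4| = e3 + e4 - |O| and its analogue with the
   Riemann-Hurwitz relation leaves no slack: if supp s1 and supp s2 meet, then
   supp s3 /\ supp s4 consists of the complement of O' and one more point p, and
   supp s1 /\ supp s2 of the complement of O and one more point l; if they are
   disjoint, then O is everything and supp s3 /\ supp s4 is the complement of O'
   together with one point a of supp s1 and one point b of supp s2. Within the
   cycle s4 the points fixed by s3 s4 then form runs ending at p (resp. at a and
   b), which s3 traverses backwards, and numbering the points along these runs
   gives the normal forms. The points p, l, a, b and the lengths of the runs
   are conjugation invariants, whence uniqueness; the Hurwitz number is obtained
   by counting the parameters for increasing e, since conjugating s2 by s1 and
   rotating the tuple show that it is symmetric in e. *)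

(* Write [Ci] for the support of [si], O for the union of C3 and C4, O' for that of C1 and C2. When
   C1 and C2 meet, the absence of slack is the chain e1 + e2 + e3 + e4 = |O| + |O'| + |C3 /\ C4| +
   |C1 /\ C2| >= |O| + |O'| + (d - |O'| + 1) + (d - |O| + 1) = 2 d + 2, whose two ends agree. The
   two extra units come from the set O /\ O': it is nonempty by transitivity and stable under both
   products, so it meets each intersection of supports outside the points already counted. The
   obstacle is that a cycle has no distinguished first entry and that pointwise computation with
   four cycles branches too much. Hence cycles are cut into lists, and products are computed by
   gluing two cycles at a point and by cancelling transpositions. The lists of a configuration carry
   no labels, so a configuration can be conjugated freely; the labels 1, ..., d enter only when its
   concatenated list is the enumeration. The admissibility inequalities then say that the blocks
   have nonnegative length. In the count, the total is e1 (d + 1 - e1) or e4 (d + 1 - e4), according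
   to whether e1 + e4 <= d + 1, and concavity of x (d + 1 - x) makes it the minimum. *)
Require Import Defs.
From mathcomp Require Import all_boot all_fingroup zify.

Set Implicit Arguments.
Unset Strict Implicit.
Unset Printing Implicit Defensive.

(** * Products of cycles *)

Notation cyc := cycle_perm.

Section CyclePerm.

Context {T : finType}.
Implicit Types (x y : T) (s c A B U V : seq T) (f g : {perm T}).

Lemma comppE f g x : compp f g x = f (g x).
Proof. exact: permM. Qed.

Lemma cycE c x : uniq c -> cyc c x = next c x.
Proof. by move=> uc; rewrite permE undup_id. Qed.

Lemma cyc_out c x : x \notin c -> cyc c x = x.
Proof. by rewrite permE next_nth mem_undup => /negPf->. Qed.

Lemma mem_cyc c x : (cyc c x \in c) = (x \in c).
Proof. by rewrite permE -mem_undup mem_next mem_undup. Qed.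

Lemma fcycle_cyc c : uniq c -> fcycle (cyc c) c.
Proof.
move=> uc; have e : frel (cyc c) =2 frel (next c) by move=> x y /=; rewrite cycE.
by rewrite (eq_cycle e) cycle_next.
Qed.

Lemma fcycle_cycE f c x : uniq c -> fcycle f c -> x \in c -> cyc c x = f x.
Proof. by move=> uc fc xc; rewrite cycE //; apply/esym/eqP/(next_cycle fc). Qed.

Lemma cyc_unique f c : uniq c -> fcycle f c -> (forall x, x \notin c -> f x = x) ->
  cyc c = f.
Proof.
move=> uc fc fout; apply/permP=> x; case: (boolP (x \in c)) => xc.
  exact: fcycle_cycE.
by rewrite cyc_out // fout.
Qed.

Lemma cyc_rot n c : uniq c -> cyc (rot n c) = cyc c.
Proof. by move=> uc; apply/permP=> x; rewrite !cycE ?rot_uniq // next_rot. Qed.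

Lemma cyc_catC A B : uniq (A ++ B) -> cyc (A ++ B) = cyc (B ++ A).
Proof. by move=> uc; rewrite -(cyc_rot (size A)) ?rot_size_cat. Qed.

Lemma cyc_rev c : uniq c -> cyc (rev c) = (cyc c)^-1%g.
Proof.
move=> uc; apply/permP=> x; apply: (@perm_inj _ (cyc c)); rewrite permKV.
by rewrite !cycE ?rev_uniq // next_rev // next_prev.
Qed.

Lemma cyc1 x : cyc [:: x] = 1%g.
Proof. by apply/permP=> y; rewrite cycE // perm1 /=; case: eqP => [->|]. Qed.

Lemma cyc_conj c g : uniq c -> (cyc c ^ g)%g = cyc (map g c).
Proof.
move=> uc; have um : uniq (map g c) by rewrite map_inj_uniq //; apply: perm_inj.
apply/permP=> x; rewrite -[x](permKV g) permJ !cycE //.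
by rewrite next_map //; apply: perm_inj.
Qed.

Lemma comppJ f g h : (compp f g ^ h)%g = compp (f ^ h)%g (g ^ h)%g.
Proof. exact: conjMg. Qed.

Lemma comppA f g h : compp f (compp g h) = compp (compp f g) h.
Proof. by rewrite /compp mulgA. Qed.

(** Two cycles with a single common point glue into one: the last entry of [A] is sent back to [x]
    by the first factor applied, and from there into [B] by the second. The cancellation and product
    formulas below rest on this. *)
Lemma cyc_cat x A B : uniq (x :: A ++ B) ->
  cyc (x :: A ++ B) = compp (cyc (x :: B)) (cyc (x :: A)).
Proof.
move=> /[dup] u0 /=; rewrite mem_cat cat_uniq negb_or.
move=> /andP[/andP[xA xB] /and3P[uA /hasPn AB uB]].
have uxA : uniq (x :: A) by rewrite /= xA.
have uxB : uniq (x :: B) by rewrite /= xB.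
have := fcycle_cyc uxB; have := fcycle_cyc uxA.
set s := cyc (x :: A); set t := cyc (x :: B) => /= pA pB.
have tA y : y \in A -> t y = y.
  move=> yA; apply: cyc_out; rewrite inE negb_or.
  apply/andP; split; first by apply: contraNneq xA => <-.
  by apply: contraL yA => /AB.
have sB y : y \in B -> s y = y.
  move=> yB; apply: cyc_out; rewrite inE negb_or (AB _ yB) andbT.
  by apply: contraNneq xB => <-.
apply: cyc_unique => //=.
- move: pA; rewrite rcons_path => /andP[pA /eqP lA].
  rewrite rcons_cat cat_path; apply/andP; split.
    apply/(pathP x) => i iA; rewrite /= comppE.
    by rewrite (eqP (pathP x pA i iA)) tA // mem_nth.
  apply/(pathP x) => i; rewrite size_rcons => iB.
  have := pathP x pB i; rewrite size_rcons => /(_ iB) /= /eqP <-.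
  case: i iB => [|i] iB; rewrite /= comppE ?lA // nth_rcons.
  by rewrite -ltnS iB sB ?mem_nth.
- move=> y; rewrite inE mem_cat !negb_or => /and3P[yx yA yB].
  by rewrite comppE /s (@cyc_out (x :: A)) /t ?cyc_out // inE negb_or yx.
Qed.

End CyclePerm.

(** Multiplicities add up under concatenation and ignore order, so distinctness of rearranged pieces
    of a list becomes linear arithmetic; this is what [uniq_by_count] exploits. *)
Lemma uniq_count {T : eqType} (s : seq T) :
  reflect (forall x, count_mem x s <= 1) (uniq s).
Proof.
apply: (iffP idP) => [us x|]; first by rewrite count_uniq_mem ?leq_b1.
elim: s => //= a s IH h; rewrite IH ?andbT => [|x].
  by rewrite -has_pred1 has_count -leqNgt; have := h a; rewrite eqxx; lia.
by have := h x; lia.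
Qed.

Lemma mem_count {T : eqType} (x : T) (s : seq T) : (x \in s) = (0 < count_mem x s).
Proof. by rewrite -has_pred1 has_count. Qed.

Ltac count_lia :=
  repeat progress rewrite /= ?(count_cat, count_rev);
  repeat match goal with |- context [count ?p ?s] => move: (count p s) => ? end;
  repeat match goal with |- context [nat_of_bool ?b] => move: (nat_of_bool b) => ? end;
  clear; lia.

Ltac uniq_by_count :=
  let z := fresh "z" in
  apply/uniq_count => z;
  repeat match goal with H : is_true (uniq ?s) |- _ =>
    move: (elimT (uniq_count s) H z); clear H end;
  count_lia.

Ltac size_lia := repeat progress rewrite /= ?(size_cat, size_rev); lia.
Ltac cat_norm := rewrite -?catA /= -?catA /= -?catA /=.

Section CycleProducts.

Context {T : finType}.
Implicit Types (a b p x y z : T) (A B L U V R G H : seq T).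

Lemma cyc_swapK y z : compp (cyc [:: z; y]) (cyc [:: z; y]) = 1%g.
Proof.
have [->|zy] := eqVneq z y.
  have -> : cyc [:: y; y] = cyc [:: y].
    by apply/permP=> x; rewrite !permE /= inE eqxx.
  by rewrite cyc1 /compp mulg1.
have u : uniq [:: z; y] by rewrite /= inE zy.
have u' : uniq [:: y; z] by rewrite /= inE eq_sym zy.
rewrite -{1}[cyc _]invgK -cyc_rev // (@cyc_catC T [:: y] [:: z] u') /compp mulgV //.
Qed.

(** By gluing, the left cycle is (U z V) followed on its right by the transposition (z y), and the
    right cycle is (z y) followed by (z L); the two transpositions meet and cancel. *)
Lemma compp_cyc_cancel y z U V L : uniq (U ++ z :: y :: V) -> uniq (y :: z :: L) ->
  compp (cyc (U ++ z :: y :: V)) (cyc (y :: z :: L))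
  = compp (cyc (U ++ z :: V)) (cyc (z :: L)).
Proof.
move=> uU uL; have -> : cyc (y :: z :: L) = compp (cyc [:: z; y]) (cyc (z :: L)).
  rewrite (@cyc_catC T [:: y] (z :: L)) // (@cyc_cat _ z L [:: y]) //.
  uniq_by_count.
have -> : cyc (U ++ z :: y :: V) = compp (cyc (U ++ z :: V)) (cyc [:: z; y]).
  rewrite cyc_catC // (@cyc_cat _ z [:: y] (V ++ U)); last by uniq_by_count.
  by rewrite (@cyc_catC T U (z :: V)) //; uniq_by_count.
by rewrite comppA -(comppA (cyc _)) cyc_swapK /compp mul1g.
Qed.

Lemma compp_cyc_cancel_run p R U V L :
  uniq (U ++ p :: rev R ++ V) -> uniq (R ++ p :: L) ->
  compp (cyc (U ++ p :: rev R ++ V)) (cyc (R ++ p :: L))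
  = compp (cyc (U ++ p :: V)) (cyc (p :: L)).
Proof.
elim: R => // y [|z R] IH uU uL; first exact: compp_cyc_cancel.
rewrite -IH; [|by move: uU uL => u u'; uniq_by_count..].
have e W : U ++ p :: rev (z :: R) ++ W = (U ++ p :: rev R) ++ z :: W.
  by rewrite rev_cons -cats1 -!catA.
have e1 : U ++ p :: rev [:: y, z & R] ++ V = (U ++ p :: rev R) ++ z :: y :: V.
  by rewrite -e rev_cons -cats1 -!catA.
by rewrite e e1 /= compp_cyc_cancel // -e1.
Qed.

Lemma compp_cyc_single p R A B : uniq (R ++ p :: A ++ B) ->
  compp (cyc (p :: rev R ++ B)) (cyc (R ++ p :: A)) = cyc (p :: A ++ B).
Proof.
move=> u; rewrite (@compp_cyc_cancel_run p R [::]); [|uniq_by_count..] => /=.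
by rewrite cyc_cat //; uniq_by_count.
Qed.

Lemma compp_cyc_disjointC A B : uniq (A ++ B) ->
  compp (cyc A) (cyc B) = compp (cyc B) (cyc A).
Proof.
rewrite cat_uniq => /and3P[_ /hasPn AB _]; apply/permP=> x; rewrite !comppE.
case: (boolP (x \in B)) => xB.
  by rewrite !(@cyc_out _ A) //; rewrite AB // mem_cyc.
rewrite (cyc_out xB) [RHS]cyc_out //; case: (boolP (x \in A)) => xA; last by rewrite cyc_out.
by apply/negP => /AB; rewrite mem_cyc xA.
Qed.

(** Cancelling both runs leaves (b H1 a H2)(b G1 a G2). The left factor is (b H2)(a H1)(a b), the
    right one is (a b)(b G1)(a G2). The transpositions cancel, (a H1) and (b G1) are disjoint and
    commute, and gluing at [b] and at [a] gives the two cycles. *)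
Lemma compp_cyc_double a b Ra Rb G1 G2 H1 H2 :
  uniq (Rb ++ b :: G1 ++ Ra ++ a :: G2 ++ H1 ++ H2) ->
  compp (cyc (b :: rev Rb ++ H1 ++ a :: rev Ra ++ H2))
        (cyc (Rb ++ b :: G1 ++ Ra ++ a :: G2))
  = compp (cyc (b :: G1 ++ H2)) (cyc (a :: G2 ++ H1)).
Proof.
move=> u; rewrite (@compp_cyc_cancel_run b Rb [::]); [|uniq_by_count..] => /=.
have -> : cyc (b :: G1 ++ Ra ++ a :: G2) = cyc (Ra ++ a :: G2 ++ b :: G1).
  by rewrite (@cyc_catC T (b :: G1) _) -?catA //; uniq_by_count.
rewrite (@compp_cyc_cancel_run a Ra (b :: H1)); [|uniq_by_count..] => /=.
have -> : cyc (b :: H1 ++ a :: H2) = compp (cyc (b :: H2)) (compp (cyc (a :: H1)) (cyc [:: a; b])).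
  rewrite -(@cyc_cat _ a [:: b] H1); last by uniq_by_count.
  have -> : b :: H1 ++ a :: H2 = b :: (H1 ++ [:: a]) ++ H2 by rewrite -catA.
  rewrite (@cyc_cat _ b (H1 ++ [:: a]) H2); last by uniq_by_count.
  by rewrite (@cyc_catC T [:: a] (b :: H1)) //; uniq_by_count.
have -> : cyc (a :: G2 ++ b :: G1) = compp (cyc [:: a; b]) (compp (cyc (b :: G1)) (cyc (a :: G2))).
  rewrite (@cyc_cat _ a G2 (b :: G1)) // ?comppA; last by uniq_by_count.
  congr compp; rewrite (@cyc_catC T [:: a] (b :: G1)); last by uniq_by_count.
  rewrite (@cyc_cat _ b G1 [:: a]); last by uniq_by_count.
  by rewrite (@cyc_catC T [:: a] [:: b]) //; uniq_by_count.
rewrite (@cyc_cat _ b) ?(@cyc_cat _ a); [|uniq_by_count..].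
have -> : forall f g h h' (t : {perm T}), compp t t = 1%g ->
    compp (compp f (compp g t)) (compp t (compp h h')) = compp f (compp (compp g h) h').
  by move=> f g h h' t; rewrite /compp !mulgA -(mulgA _ t t) => ->; rewrite mulg1.
  rewrite (@compp_cyc_disjointC (a :: H1)) ?comppA //; uniq_by_count.
exact: cyc_swapK.
Qed.

End CycleProducts.

(** * Runs of fixed points of a product *)

Section Runs.

Context {T : finType}.
Implicit Types (x y z : T) (s c A B R Q W : seq T) (f g : {perm T}) (D S : {set T}).

Lemma closed_path f S x c : (forall u, u \in S -> f u \in S) -> x \in S ->
  path (frel f) x c -> {subset c <= S}.
Proof.
move=> fS; elim: c x => //= a c IH x xS /andP[/eqP fx pc] u.
have aS : a \in S by rewrite -fx fS.
by rewrite inE => /predU1P[->//|]; apply: IH pc _.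
Qed.

Lemma fcycle_closed f S x c : (forall u, u \in S -> f u \in S) -> x \in S ->
  fcycle f c -> x \in c -> {subset c <= S}.
Proof.
move=> fS xS fc xc u uc; have [i c' ec] := rot_to xc.
rewrite -(rot_cycle i) ec in fc; have := closed_path fS xS fc; apply.
by rewrite mem_rcons -ec mem_rot.
Qed.

(** Once the first entry is fixed, the list is the orbit of [x] read until its first return;
    distinctness rules out going around several times. This removes the rotation ambiguity of cycle
    notation. *)
Lemma fcycle_cons_inj f x c c' : uniq (x :: c) -> uniq (x :: c') ->
  fcycle f (x :: c) -> fcycle f (x :: c') -> c = c'.
Proof.
move=> /= /andP[+ _] /andP[+ _]; move: {3 5}x => y.
elim: c c' y => [|a c IH] [|b c'] y //=.
- by rewrite inE => _ /norP[/eqP xb _] /andP[/eqP e _] /andP[/eqP e' _]; case: xb; rewrite -e -e'.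
- by rewrite inE => /norP[/eqP xb _] _ /andP[/eqP e _] /andP[/eqP e' _]; case: xb; rewrite -e -e'.
rewrite !inE => /norP[_ xc] /norP[_ xc'] /andP[/eqP <- p] /andP[/eqP <- p'].
by rewrite (IH c' (f y)).
Qed.

Lemma fpath_iter f x c : path (frel f) x c ->
  x :: c = [seq (f ^+ j)%g x | j <- iota 0 (size c).+1].
Proof.
elim: c x => [|a c IH] x; first by rewrite /= expg0 perm1.
move=> /andP[/eqP fx /IH e].
rewrite -[iota _ _]/(0 :: iota (1 + 0) (size c).+1) iotaDl map_cons expg0 perm1 -map_comp.
by rewrite {1}e; congr cons; apply: eq_map => j /=; rewrite -fx expgS permM.
Qed.

Lemma run_inj f D x r r' :
  path (frel f) x r -> {subset r <= D} -> f (last x r) \notin D ->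
  path (frel f) x r' -> {subset r' <= D} -> f (last x r') \notin D -> r = r'.
Proof.
elim: r r' x => [|a r IH] [|b r'] x //=.
- by move=> _ _ fx /andP[/eqP <- _] /(_ (f x)); rewrite mem_head (negPf fx) => /(_ isT).
- by move=> /andP[/eqP <- _] /(_ (f x)); rewrite mem_head => /(_ isT) ->.
move=> /andP[/eqP <- p] rD lD /andP[/eqP <- p'] rD' lD'; congr cons.
by apply: IH p _ lD p' _ lD' => u ur; [apply: rD|apply: rD']; rewrite inE ur orbT.
Qed.

(* [f] undoes [g] on [D], so the two runs trace [g^-1] from [y] until they leave [D]. *)
Lemma run_rev f g D x y z A R R' B :
  {in D, forall u, f (g u) = u} ->
  path (frel g) x (A ++ rcons R y) -> x \notin D -> {subset R <= D} ->
    {in A, forall u, u \notin D} ->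
  path (frel f) y (R' ++ rcons B z) -> z \notin D -> {subset R' <= D} ->
    {in B, forall u, u \notin D} ->
  R' = rev R.
Proof.
move=> fg; rewrite cat_path => /andP[_ pR] xD RD AD.
rewrite cat_path => /andP[pR' pB] zD RD' BD.
have lA : last x A \notin D by move: (mem_last x A); rewrite inE => /predU1P[->|/AD].
have {}pR : path (frel g^-1%g) y (rcons (rev R) (last x A)).
  have := rev_path (frel g^-1%g) (last x A) (rcons R y).
  rewrite last_rcons belast_rcons rev_cons => ->.
  rewrite (@eq_path _ _ (frel g)) // => u v /=.
  by apply/eqP/eqP => <-; rewrite ?permK ?permKV.
move: pR; rewrite rcons_path => /andP[pR /eqP lR].
apply: (@run_inj g^-1%g D y) => //.
- apply/(pathP y) => i iR; have /= /eqP e := pathP y pR' i iR.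
  have {}e : nth y (y :: R') i = g (nth y R' i).
    by apply: (@perm_inj _ f); rewrite fg ?RD' ?mem_nth.
  by rewrite /= e permK.
- set u := last y R' in pB *; apply/negP => vD.
  have e : f u = g^-1%g u by rewrite -{1}[u](permKV g) fg.
  have : f u \notin D.
    case: B BD pB => [|b B] BD /= /andP[/eqP -> _] //.
    by apply: BD; rewrite mem_head.
  by rewrite e vD.
- by move=> u; rewrite mem_rev => /RD.
- by rewrite lR.
Qed.

(** Inside [Q] the set [D] is absorbing along [f], so a path that has entered [D] stays there until
    its end. *)
Lemma split_run_r f D x Q : path (frel f) x Q ->
  (forall u, u \in Q -> f u \in Q -> u \in D -> f u \in D) ->
  exists A R, [/\ Q = A ++ R, {in A, forall u, u \notin D} & {subset R <= D}].
Proof.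
elim: Q x => [|a Q IH] x /=; first by exists [::], [::].
move=> /andP[_ pQ] h; have [//|A [R [eQ AD RD]]] := IH _ pQ.
  by move=> u uQ fuQ; apply: h; rewrite inE ?uQ ?fuQ orbT.
case: (boolP (a \in D)) => aD; last first.
  exists (a :: A), R; split; rewrite ?eQ //.
  by move=> u; rewrite inE => /predU1P[->|/AD].
have A0 : A = [::].
  case: A eQ AD => // b A eQ AD; move: pQ; rewrite eQ /= => /andP[/eqP e _].
  have := AD b (mem_head _ _); rewrite -e h //; first exact: mem_head.
  by rewrite e eQ !inE eqxx orbT.
exists [::], (a :: R); split; rewrite ?eQ ?A0 //.
by move=> u; rewrite inE => /predU1P[->|/RD].
Qed.

(** Absorption backwards along [f] is absorption forwards of the complement of [D]. *)
Lemma split_run_l f D x Q : path (frel f) x Q ->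
  (forall u, u \in Q -> f u \in Q -> f u \in D -> u \in D) ->
  exists R A, [/\ Q = R ++ A, {subset R <= D} & {in A, forall u, u \notin D}].
Proof.
move=> pQ h; have [|R [A [e RD AD]]] := @split_run_r f (~: D) x Q pQ.
  by move=> u uQ fuQ; rewrite !inE; apply: contra; apply: h.
exists R, A; split => // u.
  by move/RD; rewrite inE negbK.
by move/AD; rewrite inE.
Qed.

End Runs.

(** * Hurwitz factorizations with four factors *)

Lemma is_cycleP {T : finType} n (s : {perm T}) :
  reflect (exists c, [/\ uniq c, size c = n & s = cyc c]) (is_cycle n s).
Proof.
apply: (iffP existsP) => [[c /andP[uc /eqP ->]]|[c [uc sc ->]]].
  by exists c; rewrite size_tuple.
by exists (Tuple (introT eqP sc)); rewrite /= uc eqxx.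
Qed.

(** The stabilizer of a set is a group, so stability under generators passes to the generated group;
    conversely an orbit is itself a stable set. *)
Lemma transitive_genP {T : finType} (A : {set {perm T}}) : 0 < #|T| ->
  reflect (forall S : {set T}, S != set0 ->
             (forall s x, s \in A -> x \in S -> s x \in S) -> S = setT)
          [transitive <<A>>%g, on [set: T] | 'P].
Proof.
move=> T0; apply: (iffP idP) => [tr S /set0Pn[x xS] stS|h].
  have AS : <<A>>%g \subset 'N(S | 'P)%g.
    rewrite gen_subG; apply/subsetP => s sA; rewrite !inE /=.
    by apply/subsetP => y yS; rewrite inE /= apermE stS.
  apply/setP => y; rewrite inE.
  have [a aA ->] := atransP2 tr (in_setT x) (in_setT y).
  by rewrite (astabs_act _ (subsetP AS a aA)).
have [x _] : exists x, x \in T by apply/card_gt0P.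
have e : orbit 'P <<A>>%G x = setT.
  apply: h => [|s y sA]; first by apply/set0Pn; exists x; apply: orbit_refl.
  case/orbitP => a aA <-; apply/orbitP; exists (a * s)%g; last by rewrite actM.
  by rewrite groupM // mem_gen.
by apply/imsetP; exists x.
Qed.

(** The form used in all arguments: cycles come with their lists, the product is bracketed into two
    mutually inverse pairs, and transitivity is the absence of a proper nonempty stable set. *)
Record hurwitz4 (d e1 e2 e3 e4 : nat) (s1 s2 s3 s4 : 'S_d) : Prop := Hurwitz4 {
  hurwitz4_cycle1 : exists c, [/\ uniq c, size c = e1 & s1 = cyc c];
  hurwitz4_cycle2 : exists c, [/\ uniq c, size c = e2 & s2 = cyc c];
  hurwitz4_cycle3 : exists c, [/\ uniq c, size c = e3 & s3 = cyc c];
  hurwitz4_cycle4 : exists c, [/\ uniq c, size c = e4 & s4 = cyc c];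
  hurwitz4_prod : compp (compp s1 s2) (compp s3 s4) = 1%g;
  hurwitz4_transitive : forall S : {set 'I_d}, S != set0 ->
    (forall x, x \in S -> s1 x \in S) -> (forall x, x \in S -> s2 x \in S) ->
    (forall x, x \in S -> s3 x \in S) -> (forall x, x \in S -> s4 x \in S) ->
    S = setT }.

Lemma forall_tnth4 {T U : Type} (P : T -> U -> bool) a1 a2 a3 a4 b1 b2 b3 b4 :
  [forall i, P (tnth [tuple a1; a2; a3; a4] i) (tnth [tuple b1; b2; b3; b4] i)]
  = [&& P a1 b1, P a2 b2, P a3 b3 & P a4 b4].
Proof.
apply/forallP/and4P => [h|[h1 h2 h3 h4] [[|[|[|[|i]]]] lt_i]];
  last by []; rewrite ?(tnth_nth a1) ?(tnth_nth b1) //.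
by split; [have := h (@Ordinal 4 0 isT)|have := h (@Ordinal 4 1 isT)
          |have := h (@Ordinal 4 2 isT)|have := h (@Ordinal 4 3 isT)];
  rewrite !(tnth_nth a1) !(tnth_nth b1).
Qed.

Lemma hurwitz4P d e1 e2 e3 e4 (s1 s2 s3 s4 : 'S_d) : 0 < d ->
  reflect (hurwitz4 e1 e2 e3 e4 s1 s2 s3 s4)
    (hurwitz_factorization [tuple e1; e2; e3; e4] [tuple s1; s2; s3; s4]).
Proof.
move=> d0; rewrite /hurwitz_factorization (forall_tnth4 (@is_cycle 'I_d)) /=.
have -> : compp s1 (compp s2 (compp s3 (compp s4 1%g))) = compp (compp s1 s2) (compp s3 s4).
  by rewrite {4}/compp mul1g comppA.
have d0' : 0 < #|'I_d| by rewrite card_ord.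
apply: (iffP and3P).
  case=> /and4P[/is_cycleP c1 /is_cycleP c2 /is_cycleP c3 /is_cycleP c4] /eqP pr.
  move=> /(transitive_genP _ d0') tr; split=> // S S0 h1 h2 h3 h4; apply: tr => // s x.
  rewrite !inE => /or4P[]/eqP-> xS; [exact: h1|exact: h2|exact: h3|exact: h4].
case=> /is_cycleP c1 /is_cycleP c2 /is_cycleP c3 /is_cycleP c4 /eqP pr tr.
split=> //; first by rewrite c1 c2 c3.
apply/transitive_genP => // S S0 h; apply: tr => // x; apply: h; rewrite !inE eqxx ?orbT //.
Qed.

(** * The intersections of the supports *)

Section TwoCycles.

Context {T : finType}.
Implicit Types (x y i : T) (c d : seq T) (S : {set T}).

Lemma cyc_neq c x : uniq c -> 1 < size c -> x \in c -> cyc c x != x.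
Proof.
move=> uc sc xc; apply: contraTN sc => /eqP cx; rewrite -leqNgt.
have cS : {subset c <= [set x]}.
  apply: (@fcycle_closed _ (cyc c) _ x) => //; last exact: fcycle_cyc.
  - by move=> u; rewrite !inE => /eqP->; rewrite cx.
  - by rewrite inE.
by rewrite -(cards1 x) cardE; apply: uniq_leq_size => // u /cS; rewrite mem_enum.
Qed.

(** If one of the cycles fixed the point handed to it, the other would have to fix [x] too, although
    a cycle of length at least two moves each of its entries. *)
Lemma compp_fixed c d x : uniq c -> uniq d -> 1 < size c -> 1 < size d ->
  cyc c (cyc d x) = x -> (x \in c) || (x \in d) ->
  [/\ x \in c, x \in d, cyc d x \in c & cyc d x \in d].
Proof.
move=> uc ud sc sd e xcd.
have xd : x \in d.
  apply: contraTT xcd => xd; rewrite (cyc_out xd) in e; rewrite negb_or xd andbT.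
  by apply: contraTN isT => xc; have := cyc_neq uc sc xc; rewrite e eqxx.
have gxc : cyc d x \in c.
  apply: contraTT isT => gxc; rewrite (cyc_out gxc) in e.
  by have := cyc_neq ud sd xd; rewrite e eqxx.
by split=> //; [rewrite -e mem_cyc | rewrite mem_cyc].
Qed.

(** Without a common point in [S], the two cycles would act on disjoint parts of [S]. Then [S] would
    be closed under one cycle that it meets, hence contain that whole support, and with it the
    common point [i]. *)
Lemma closed_meets_inter c d S i x : uniq c -> uniq d -> i \in c -> i \in d ->
  (forall u, u \in S -> cyc c (cyc d u) \in S) ->
  x \in S -> (x \in c) || (x \in d) -> exists p, [/\ p \in S, p \in c & p \in d].
Proof.
move=> uc ud ic id fS xS xcd.
suff /exists_inP[p pS /andP[pc pd]] : [exists p in S, (p \in c) && (p \in d)] by exists p.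
apply: contraTT isT => /exists_inPn /= h.
have h' u : u \in S -> u \in c -> u \notin d.
  by move=> uS cu; apply: contraNN (h u uS) => ->; rewrite cu.
case: (boolP [exists y in S, y \in c]) => [/exists_inP[y yS yc]|/exists_inPn hc].
  have sub : {subset c <= S :&: [set z in c]}.
    apply: (@fcycle_closed _ (cyc c) _ y) => //; [|by rewrite !inE yS|exact: fcycle_cyc].
    move=> u; rewrite !inE => /andP[uS cu]; rewrite mem_cyc cu andbT.
    by have := fS u uS; rewrite (cyc_out (h' _ uS cu)).
  by have := sub i ic; rewrite !inE => /andP[iS _]; have := h i iS; rewrite ic id.
have xd : x \in d by move: xcd; rewrite (negPf (hc x xS)).
have sub : {subset d <= S :&: [set z in d]}.
  apply: (@fcycle_closed _ (cyc d) _ x) => //; [|by rewrite !inE xS|exact: fcycle_cyc].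
  move=> u; rewrite !inE => /andP[uS du]; rewrite mem_cyc du andbT.
  have := fS u uS; case: (boolP (cyc d u \in c)) => [gc|gc]; last by rewrite (cyc_out gc).
  by move=> /hc; rewrite mem_cyc gc.
by have := sub i id; rewrite !inE => /andP[iS _]; have := h i iS; rewrite ic id.
Qed.

End TwoCycles.

Section Structure.

Context {d : nat}.
Implicit Types (c : seq 'I_d).

Variables (c1 c2 c3 c4 : seq 'I_d).
Let C1 := [set x in c1].
Let C2 := [set x in c2].
Let C3 := [set x in c3].
Let C4 := [set x in c4].

Hypotheses (u1 : uniq c1) (u2 : uniq c2) (u3 : uniq c3) (u4 : uniq c4).
Hypotheses (n1 : 1 < size c1) (n2 : 1 < size c2) (n3 : 1 < size c3) (n4 : 1 < size c4).
Hypothesis sum_size : size c1 + size c2 + (size c3 + size c4) = 2 * d + 2.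
Hypothesis prod1 : compp (compp (cyc c1) (cyc c2)) (compp (cyc c3) (cyc c4)) = 1%g.
Hypothesis conn : forall S : {set 'I_d}, S != set0 ->
    (forall x, x \in S -> cyc c1 x \in S) -> (forall x, x \in S -> cyc c2 x \in S) ->
    (forall x, x \in S -> cyc c3 x \in S) -> (forall x, x \in S -> cyc c4 x \in S) ->
    S = setT.

Let card_cycle c (uc : uniq c) : #|[set x in c]| = size c.
Proof. by rewrite cardsE; apply/card_uniqP. Qed.

Let prodE x : cyc c1 (cyc c2 (cyc c3 (cyc c4 x))) = x.
Proof. by have /permP/(_ x) := prod1; rewrite !comppE perm1. Qed.

Let prodE' x : cyc c3 (cyc c4 (cyc c1 (cyc c2 x))) = x.
Proof.
have: compp (compp (cyc c3) (cyc c4)) (compp (cyc c1) (cyc c2)) = 1%g.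
  by apply/eqP; move/eqP: prod1; rewrite /compp -!eq_invg_mul => /eqP <-; rewrite invgK.
by move/permP/(_ x); rewrite !comppE perm1.
Qed.

(** A point fixed by all four cycles would be a stable singleton, hence everything, although [c1]
    has two distinct entries. *)
Lemma moved_somewhere x : x \in (C1 :|: C2) :|: (C3 :|: C4).
Proof.
rewrite !inE; apply: contraTT isT => /norP[/norP[x1 x2] /norP[x3 x4]].
have e : [set x] = setT.
  apply: conn => [|y|y|y|y]; first by apply/set0Pn; exists x; rewrite inE.
  1-4: by rewrite inE => /eqP ->; rewrite cyc_out // set11.
case: c1 n1 x1 => // y c _; rewrite inE negb_or => /andP[xy _].
by have := in_setT y; rewrite -e inE eq_sym (negPf xy).
Qed.

Lemma fixed12 x : x \notin C1 :|: C2 ->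
  [/\ x \in c3, x \in c4, cyc c4 x \in c3, cyc c4 x \in c4 & cyc c3 (cyc c4 x) = x].
Proof.
move=> x12; have := moved_somewhere x; rewrite inE (negPf x12) /= !inE => x34.
have e : cyc c3 (cyc c4 x) = x.
  have := prodE' x; rewrite (@cyc_out _ c2) 1?(@cyc_out _ c1) //.
    by apply: contraNN x12; rewrite !inE => ->.
  by apply: contraNN x12; rewrite !inE => ->; rewrite orbT.
by have [] := compp_fixed u3 u4 n3 n4 e x34.
Qed.

Lemma fixed34 x : x \notin C3 :|: C4 ->
  [/\ x \in c1, x \in c2, cyc c2 x \in c1, cyc c2 x \in c2 & cyc c1 (cyc c2 x) = x].
Proof.
move=> x34; have := moved_somewhere x; rewrite inE (negPf x34) orbF !inE => x12.
have e : cyc c1 (cyc c2 x) = x.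
  have := prodE x; rewrite (@cyc_out _ c4) 1?(@cyc_out _ c3) //.
    by apply: contraNN x34; rewrite !inE => ->.
  by apply: contraNN x34; rewrite !inE => ->; rewrite orbT.
by have [] := compp_fixed u1 u2 n1 n2 e x12.
Qed.

Let mem34 x : (cyc c3 (cyc c4 x) \in C3 :|: C4) = (x \in C3 :|: C4).
Proof.
rewrite !inE mem_cyc; case: (boolP (x \in c4)) => x4.
  rewrite orbT; case: (boolP (cyc c4 x \in c3)) => //= gx.
  by rewrite (cyc_out gx) mem_cyc.
rewrite (cyc_out x4) orbF; case: (boolP (x \in c3)) => //= x3.
by rewrite (cyc_out x3) (negPf x4).
Qed.

Let mem12 x : (cyc c1 (cyc c2 x) \in C1 :|: C2) = (x \in C1 :|: C2).
Proof.
rewrite !inE mem_cyc; case: (boolP (x \in c2)) => x2.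
  rewrite orbT; case: (boolP (cyc c2 x \in c1)) => //= gx.
  by rewrite (cyc_out gx) mem_cyc.
rewrite (cyc_out x2) orbF; case: (boolP (x \in c1)) => //= x1.
by rewrite (cyc_out x1) (negPf x2).
Qed.

(** The product of the last two cycles is inverse to that of the first two, so each product
    preserves both unions of supports. *)
Let mem12_tau x : (cyc c3 (cyc c4 x) \in C1 :|: C2) = (x \in C1 :|: C2).
Proof. by rewrite -mem12 prodE. Qed.

Let mem34_tau x : (cyc c1 (cyc c2 x) \in C3 :|: C4) = (x \in C3 :|: C4).
Proof. by rewrite -mem34 prodE'. Qed.

Lemma inter_single i j : i \in c3 -> i \in c4 -> j \in c1 -> j \in c2 ->
  exists p l, [/\ p \in C1 :|: C2, C3 :&: C4 = p |: ~: (C1 :|: C2),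
                  l \in C3 :|: C4 & C1 :&: C2 = l |: ~: (C3 :|: C4)].
Proof.
move=> i3 i4 j1 j2; set O := C3 :|: C4; set O' := C1 :|: C2.
(* If [O] and [O'] were disjoint, [c1] and [c2] would fix [O] pointwise; then [O] would be stable
   under all four cycles, hence everything, against [j]. *)
have [x xO xO'] : exists2 x, x \in O & x \in O'.
  apply/exists_inP; apply: contraTT isT => /exists_inPn h.
  have out x : x \in O -> (x \notin c1) && (x \notin c2).
    by move/h; rewrite !inE negb_or.
  have e : O = setT.
    apply: conn => [|x xO|x xO|x xO|x xO].
    - by apply/set0Pn; exists i; rewrite !inE i3.
    - by have /andP[x1 _] := out x xO; rewrite cyc_out.
    - by have /andP[_ x2] := out x xO; rewrite cyc_out.
    - case: (boolP (x \in c3)) => x3; last by rewrite cyc_out.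
      by rewrite !inE mem_cyc x3.
    - case: (boolP (x \in c4)) => x4; last by rewrite cyc_out.
      by rewrite !inE mem_cyc x4 orbT.
  by have := out j; rewrite e inE j1 => /(_ isT).
have [|||p [pC p3 p4]] := @closed_meets_inter _ _ _ (O :&: O') _ x u3 u4 i3 i4.
- by move=> u; rewrite !(in_setI, mem34, mem12_tau).
- by rewrite inE xO.
- by move: xO; rewrite !inE.
have [|||l [lC l1 l2]] := @closed_meets_inter _ _ _ (O :&: O') _ x u1 u2 j1 j2.
- by move=> u; rewrite !(in_setI, mem34_tau, mem12).
- by rewrite inE xO.
- by move: xO'; rewrite !inE.
move: pC lC; rewrite !in_setI => /andP[pO pO'] /andP[lO lO'].
have sD : p |: ~: O' \subset C3 :&: C4.
  apply/subsetP => u; rewrite in_setU1 in_setC => /predU1P[->|/fixed12[]].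
    by rewrite !inE p3.
  by rewrite !inE => -> ->.
have sE : l |: ~: O \subset C1 :&: C2.
  apply/subsetP => u; rewrite in_setU1 in_setC => /predU1P[->|/fixed34[]].
    by rewrite !inE l1.
  by rewrite !inE => -> ->.
have pD : p \notin ~: O' by rewrite inE negbK.
have lE : l \notin ~: O by rewrite inE negbK.
have cD := subset_leq_card sD; have cE := subset_leq_card sE.
(* Adding both cardinality formulas gives a total of 2 d + 2, which is also the sum of the two lower
   bounds [cD] and [cE]; so both inclusions are equalities. *)
have := cardsUI C3 C4; have := cardsUI C1 C2; have := cardsC O; have := cardsC O'.
rewrite card_ord !card_cycle // -/O -/O' => h1 h2 h3 h4.
rewrite !cardsU1 pD lE in cD cE.
exists p, l; split=> //; apply/esym/eqP; rewrite eqEcard ?sD ?sE !cardsU1 ?pD ?lE /=.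
  move: h1 h2 h3 h4 cD cE sum_size; move: #|O| #|O'| #|~: O| #|~: O'| => a b a' b'.
  by move: #|_| #|_| (size c1) (size c2) (size c3) (size c4); clear; lia.
move: h1 h2 h3 h4 cD cE sum_size; move: #|O| #|O'| #|~: O| #|~: O'| => a b a' b'.
by move: #|_| #|_| (size c1) (size c2) (size c3) (size c4); clear; lia.
Qed.

Lemma inter_double : size c3 + size c4 > d -> [disjoint c1 & c2] ->
  exists a b, [/\ a \in c1, b \in c2, C3 :|: C4 = setT
                 & C3 :&: C4 = a |: (b |: ~: (C1 :|: C2))].
Proof.
move=> big dis; set O := C3 :|: C4; set O' := C1 :|: C2.
have disC : C1 :&: C2 = set0.
  apply/setP => x; rewrite !inE; apply/negP => /andP[x1 x2].
  by rewrite (disjointFr dis x1) in x2.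
have c12 : #|O'| = size c1 + size c2 by rewrite cardsU disC cards0 subn0 !card_cycle.
have e : O = setT.
  apply/setP => x; rewrite in_setT; apply: contraTT isT => /fixed34[x1 x2 _ _ _].
  by rewrite (disjointFr dis x1) in x2.
have cI : #|C3 :&: C4| = size c3 + size c4 - d.
  by rewrite cardsI !card_cycle // -/O e cardsT card_ord.
have [i] : exists i, i \in C3 :&: C4 by apply/set0Pn; rewrite -card_gt0 cI; lia.
rewrite !inE => /andP[i3 i4].
(* Disjointness makes [C1] and [C2] separately stable under the product of [c3] and [c4], so each of
   them, and not only their union, meets the intersection of the other two supports. The two points
   exhaust it, because e3 + e4 - d = (d - e1 - e2) + 2. *)
have stab1 u : u \in C1 -> cyc c3 (cyc c4 u) \in C1.
  move=> uC; have := mem12_tau u; rewrite !inE; move: uC; rewrite inE => uC.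
  rewrite uC /=; case/orP => // v2; move: (prodE u).
  rewrite (@cyc_out _ c1) => [eu|]; last by rewrite (disjointFl dis) // mem_cyc.
  by move: uC; rewrite -eu (disjointFl dis) // mem_cyc.
have stab2 u : u \in C2 -> cyc c3 (cyc c4 u) \in C2.
  move=> uC; have := mem12_tau u; rewrite !inE; move: uC; rewrite inE => uC.
  rewrite uC orbT /=; case/orP => // v1; move: (prodE u).
  rewrite (@cyc_out _ c2) => [eu|]; last by rewrite (disjointFr dis).
  by move: uC; rewrite -eu (disjointFr dis) // mem_cyc.
have inO u : (u \in c3) || (u \in c4) by move: (in_setT u); rewrite -e !inE.
have x1 : head i c1 \in C1 by rewrite inE -nth0 mem_nth ?(ltnW n1).
have x2 : head i c2 \in C2 by rewrite inE -nth0 mem_nth ?(ltnW n2).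
have [a [aC a3 a4]] := closed_meets_inter u3 u4 i3 i4 stab1 x1 (inO _).
have [b [bC b3 b4]] := closed_meets_inter u3 u4 i3 i4 stab2 x2 (inO _).
move: (aC) (bC); rewrite !inE => a1 b2; exists a, b; split=> //.
have bD : b \notin ~: O' by rewrite !inE b2 orbT.
have aD : a \notin b |: ~: O'.
  rewrite !inE a1 orbF; apply: contraTN b2 => /eqP <-.
  by rewrite (disjointFr dis).
apply/esym/eqP; rewrite eqEcard cI !cardsU1 aD bD; apply/andP; split; last first.
  have := cardsC O'; rewrite card_ord c12; move: sum_size big.
  by move: #|_| (size c1) (size c2) (size c3) (size c4); clear; lia.
apply/subsetP => u; rewrite in_setU1 in_setU1 in_setC.
case/or3P => [/eqP->|/eqP->|/fixed12[]]; rewrite !inE ?a3 ?b3 // => -> ->//.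
Qed.

End Structure.

(** * Lists for two cycles that undo each other on a set *)

Section NormalLists.

Context {T : finType}.
Implicit Types (a b p u v x y z : T) (c A B R G H Q W : seq T) (D : {set T}).

Lemma rot_cyc c p : uniq c -> p \in c ->
  exists Q, [/\ uniq (p :: Q), cyc c = cyc (p :: Q), p :: Q =i c, size (p :: Q) = size c
              & path (frel (cyc c)) p (rcons Q p)].
Proof.
move=> uc pc; have [i Q e] := rot_to pc.
have uQ : uniq (p :: Q) by rewrite -e rot_uniq.
have eQ : cyc c = cyc (p :: Q) by rewrite -e cyc_rot.
exists Q; split=> //; first by move=> u; rewrite -e mem_rot.
- by rewrite -e size_rot.
- by rewrite eQ; apply: (fcycle_cyc uQ).
Qed.

Variables (c3 c4 : seq T) (D : {set T}).
Hypotheses (u3 : uniq c3) (u4 : uniq c4).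
Hypothesis D34 : {in D, forall u,
  [/\ u \in c3, u \in c4, cyc c4 u \in c3, cyc c4 u \in c4 & cyc c3 (cyc c4 u) = u]}.

Let undo : {in D, forall u, cyc c3 (cyc c4 u) = u}.
Proof. by move=> u /D34[]. Qed.

(** The image under [cyc c4] of a point of [D] lies again in both supports, hence in [D] as long as
    the path avoids the exceptional points: [D] is absorbing. *)
Lemma split_cycle4 x Q : {subset Q <= c4} ->
  {in c3, forall u, u \in c4 -> u \in Q -> u \in D} -> path (frel (cyc c4)) x Q ->
  exists A R, [/\ Q = A ++ R, {in A, forall u, u \notin D} & {subset R <= D}].
Proof.
move=> Q4 QD /split_run_r; apply=> u uQ fuQ /D34[_ _ m3 m4 _].
by apply: QD.
Qed.

(** Backwards this time: if [cyc c3 u] is in [D], then [cyc c4] sends it back to [u], which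
    therefore lies in both supports. *)
Lemma split_cycle3 x Q : {subset Q <= c3} ->
  {in c3, forall u, u \in c4 -> u \in Q -> u \in D} -> path (frel (cyc c3)) x Q ->
  exists R A, [/\ Q = R ++ A, {subset R <= D} & {in A, forall u, u \notin D}].
Proof.
move=> Q3 QD /split_run_l; apply=> u uQ fuQ vD.
have [_ _ m3 m4 e] := D34 vD.
have <- : cyc c4 (cyc c3 u) = u by apply: (@perm_inj _ (cyc c3)).
apply: QD => //; have -> // : cyc c4 (cyc c3 u) = u.
by apply: (@perm_inj _ (cyc c3)).
Qed.

Lemma single_lists p : p \notin D ->
  (forall u, (u \in c3) && (u \in c4) = (u == p) || (u \in D)) ->
  exists R A B, [/\ uniq (R ++ p :: A ++ B), R =i D,
    [/\ cyc c4 = cyc (R ++ p :: A), size (R ++ p :: A) = size c4 & R ++ p :: A =i c4]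
  & [/\ cyc c3 = cyc (p :: rev R ++ B), size (p :: rev R ++ B) = size c3
      & p :: rev R ++ B =i c3]].
Proof.
move=> pD h; have /andP[p3 p4] : (p \in c3) && (p \in c4) by rewrite h eqxx.
have [Q [uQ eQ mQ sQ pathQ]] := rot_cyc u4 p4.
have [W [uW eW mW sW pathW]] := rot_cyc u3 p3.
have QD : {in c3, forall u, u \in c4 -> u \in Q -> u \in D}.
  move=> u v3 v4 vQ; have : (u \in c3) && (u \in c4) by rewrite v3.
  by rewrite h => /predU1P[e|//]; move: uQ; rewrite /= -e vQ.
have WD : {in c3, forall u, u \in c4 -> u \in W -> u \in D}.
  move=> u v3 v4 vW; have : (u \in c3) && (u \in c4) by rewrite v3.
  by rewrite h => /predU1P[e|//]; move: uW; rewrite /= -e vW.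
have [||A [R [defQ AD RD]]] := @split_cycle4 p Q _ QD.
- by move=> u uQ'; rewrite -mQ inE uQ' orbT.
- by move: pathQ; rewrite rcons_path => /andP[].
have [||R' [B [defW RD' BD]]] := @split_cycle3 p W _ WD.
- by move=> u uW'; rewrite -mW inE uW' orbT.
- by move: pathW; rewrite rcons_path => /andP[].
have eR : R' = rev R.
  apply: (run_rev undo (x := p) (A := A) (y := p) (B := B) (z := p)) => //.
    by rewrite -rcons_cat -defQ.
  by rewrite -rcons_cat -defW.
subst R' Q W; exists R, A, B.
have mR : R =i D.
  move=> u; apply/idP/idP => [/RD//|uD]; have [_ v4 _ _ _] := D34 uD.
  move: v4; rewrite -mQ inE mem_cat => /or3P[/eqP e|/AD|//].
    by rewrite -e uD in pD.
  by rewrite uD.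
split=> //.
(* A common entry of [A] and [B] would lie in both supports and differ from [p], hence be in [D],
   which [A] avoids. *)
- have AB z : count_mem z A = 0 \/ count_mem z B = 0.
    case: (boolP (z \in A)) => zA; last by left; apply/count_memPn.
    case: (boolP (z \in B)) => zB; last by right; apply/count_memPn.
    have := AD z zA; rewrite QD ?mem_cat ?zA //.
      by rewrite -mW inE mem_cat zB !orbT.
    by rewrite -mQ inE mem_cat zA !orbT.
  apply/uniq_count=> z; move: (AB z) (elimT (uniq_count _) uQ z) (elimT (uniq_count _) uW z).
  by count_lia.
- split; first by rewrite eQ -cat_cons cyc_catC.
    by rewrite -sQ /= !size_cat /= addnS addnC.
  by move=> u; rewrite -mQ -cat_cons !mem_cat orbC.
Qed.

Lemma double_lists a b : a \notin D -> b \notin D -> a != b ->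
  (forall u, (u \in c3) && (u \in c4) = [|| u == a, u == b | u \in D]) ->
  exists Ra Rb G1 G2 H1 H2,
  [/\ uniq (Rb ++ b :: G1 ++ Ra ++ a :: G2 ++ H1 ++ H2), Rb ++ Ra =i D,
    [/\ cyc c4 = cyc (Rb ++ b :: G1 ++ Ra ++ a :: G2),
        size (Rb ++ b :: G1 ++ Ra ++ a :: G2) = size c4
      & Rb ++ b :: G1 ++ Ra ++ a :: G2 =i c4]
  & [/\ cyc c3 = cyc (b :: rev Rb ++ H1 ++ a :: rev Ra ++ H2),
        size (b :: rev Rb ++ H1 ++ a :: rev Ra ++ H2) = size c3
      & b :: rev Rb ++ H1 ++ a :: rev Ra ++ H2 =i c3]].
Proof.
move=> aD bD ab h.
have /andP[a3 a4] : (a \in c3) && (a \in c4) by rewrite h eqxx.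
have /andP[b3 b4] : (b \in c3) && (b \in c4) by rewrite h eqxx orbT.
(* Starting [c4] at [a] and [c3] at [b] makes the runs face each other: the stretch of [c4] from [a]
   to [b] ends with the run that opens the stretch of [c3] from [b] to [a], and similarly for the
   remaining stretches. *)
have [Q [uQ eQ mQ sQ pathQ]] := rot_cyc u4 a4.
have [W [uW eW mW sW pathW]] := rot_cyc u3 b3.
have bQ : b \in Q by move: b4; rewrite -mQ inE eq_sym (negPf ab).
have aW : a \in W by move: a3; rewrite -mW inE (negPf ab).
have [Q2 [Q1 defQ]] : exists Q2 Q1, Q = Q2 ++ b :: Q1.
  by case/splitPr: bQ => Q2 Q1; exists Q2, Q1.
have [W1 [W2 defW]] : exists W1 W2, W = W1 ++ a :: W2.
  by case/splitPr: aW => W1 W2; exists W1, W2.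
subst Q W.
have notab (E : seq T) : a \notin E -> b \notin E -> {in c3, forall u, u \in c4 -> u \in E -> u \in D}.
  move=> aE bE u v3 v4 vE; have : (u \in c3) && (u \in c4) by rewrite v3.
  by rewrite h => /or3P[/eqP e|/eqP e|//]; rewrite -e vE in aE bE.
move: pathQ pathW; rewrite !rcons_cat !cat_path /=.
move=> /and3P[pQ2 lQ2 pQ1] /and3P[pW1 lW1 pW2].
have [aQ2 aQ1 bQ2 bQ1] : [/\ a \notin Q2, a \notin Q1, b \notin Q2 & b \notin Q1].
  move: uQ; rewrite /= mem_cat inE cat_uniq /= !negb_or.
  by case/andP=> /and3P[-> _ ->] /and4P[_ /andP[-> _] -> _].
have [aW1 aW2 bW1 bW2] : [/\ a \notin W1, a \notin W2, b \notin W1 & b \notin W2].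
  move: uW; rewrite /= mem_cat inE cat_uniq /= !negb_or.
  by case/andP=> /and3P[-> _ ->] /and4P[_ /andP[-> _] -> _].
have pQ1' : path (frel (cyc c4)) b Q1 by move: pQ1; rewrite rcons_path => /andP[].
have pW2' : path (frel (cyc c3)) a W2 by move: pW2; rewrite rcons_path => /andP[].
have [|G2 [Rb [defQ2 G2D RbD]]] := split_cycle4 _ (notab _ aQ2 bQ2) pQ2.
  by move=> u uu; rewrite -mQ inE mem_cat uu !orbT.
have [|G1 [Ra [defQ1 G1D RaD]]] := split_cycle4 _ (notab _ aQ1 bQ1) pQ1'.
  by move=> u uu; rewrite -mQ inE mem_cat inE uu !orbT.
have [|Sb [H1 [defW1 SbD H1D]]] := split_cycle3 _ (notab _ aW1 bW1) pW1.
  by move=> u uu; rewrite -mW inE mem_cat uu !orbT.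
have [|Sa [H2 [defW2 SaD H2D]]] := split_cycle3 _ (notab _ aW2 bW2) pW2'.
  by move=> u uu; rewrite -mW inE mem_cat inE uu !orbT.
have eb : Sb = rev Rb.
  apply: (run_rev undo (x := a) (A := G2) (y := b) (B := H1) (z := a)) => //.
    by rewrite -rcons_cat -defQ2 rcons_path pQ2.
  by rewrite -rcons_cat -defW1 rcons_path pW1.
have ea : Sa = rev Ra.
  apply: (run_rev undo (x := b) (A := G1) (y := a) (B := H2) (z := b)) => //.
    by rewrite -rcons_cat -defQ1.
  by rewrite -rcons_cat -defW2.
subst Sa Sb Q1 Q2 W1 W2; exists Ra, Rb, G1, G2, H1, H2.
have memQ u : u \in D -> u \in Rb ++ Ra.
  move=> uD; have [_ v4 _ _ _] := D34 uD; move: v4.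
  rewrite -mQ !(inE, mem_cat) => /or4P[/eqP e| | /eqP e|].
  - by rewrite -e uD in aD.
  - by case/orP=> [/G2D|->//]; rewrite uD.
  - by rewrite -e uD in bD.
  - by case/orP=> [/G1D|->//]; rewrite ?uD ?orbT.
split.
- have GH z : count_mem z (G1 ++ G2) = 0 \/ count_mem z (H1 ++ H2) = 0.
    case: (boolP (z \in G1 ++ G2)) => zA; last by left; apply/count_memPn.
    case: (boolP (z \in H1 ++ H2)) => zB; last by right; apply/count_memPn.
    have zc : (z \in c3) && (z \in c4).
      rewrite -mW -mQ !(inE, mem_cat); move: zA zB; rewrite !mem_cat.
      by do 2!case/orP=> ->; rewrite !orbT.
    have zD : z \notin D by move: zA; rewrite mem_cat => /orP[/G1D|/G2D].
    have zQ : z \in (G2 ++ Rb) ++ (G1 ++ Ra).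
      by move: zA; rewrite !mem_cat => /orP[]->; rewrite ?orbT.
    move: zc; rewrite h (negPf zD) orbF; case/orP=> /eqP e; subst z.
      by move: zQ; rewrite mem_cat (negPf aQ1) (negPf aQ2).
    by move: zQ; rewrite mem_cat (negPf bQ1) (negPf bQ2).
  apply/uniq_count=> z; move: (GH z) (elimT (uniq_count _) uQ z) (elimT (uniq_count _) uW z).
  by count_lia.
- move=> u; apply/idP/idP => [|/memQ//].
  by rewrite mem_cat => /orP[/RbD|/RaD].
- split.
  + rewrite eQ (_ : _ :: _ = (a :: G2) ++ (Rb ++ b :: G1 ++ Ra)) -?catA //.
    by rewrite cyc_catC -?catA //; move: uQ; rewrite /= -!catA.
  + by rewrite -sQ; repeat progress rewrite /= ?size_cat; clear; lia.
  + by move=> u; rewrite -mQ !(mem_cat, inE) -!orbA; do !case: (_ \in _) => //; do !case: eqP.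
- rewrite eW -sW; split=> //; rewrite /= -?catA //.
  by move=> u; rewrite -mW -!catA.
Qed.

End NormalLists.

(** * Normal forms *)

Section Labels.

Context {d : nat}.
Implicit Types (a b k n : nat) (x : 'I_d) (X Y Z L : seq 'I_d).

Lemma mem_asc a b x : (x \in asc d a b) = (a <= x.+1 <= b).
Proof. by rewrite mem_filter mem_enum andbT. Qed.

Lemma asc_uniq a b : uniq (asc d a b).
Proof. by rewrite filter_uniq // enum_uniq. Qed.

Lemma val_asc a b : 0 < a -> b <= d -> map val (asc d a b) = iota a.-1 (b.+1 - a).
Proof.
move=> a0 bd; apply: (irr_sorted_eq ltn_trans ltnn).
- rewrite sorted_map; apply: (@sorted_filter _ (relpre val ltn)).
    by move=> x y z; apply: ltn_trans.
  by rewrite -sorted_map val_enum_ord iota_ltn_sorted.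
- exact: iota_ltn_sorted.
move=> i; rewrite mem_iota; apply/mapP/idP => [[x]|h].
  by rewrite mem_asc => h -> /=; lia.
have id' : i < d by lia.
by exists (Ordinal id') => //; rewrite mem_asc /=; lia.
Qed.

Lemma size_asc a b : 0 < a -> b <= d -> size (asc d a b) = b.+1 - a.
Proof. by move=> a0 bd; rewrite -(size_map val) val_asc // size_iota. Qed.

Lemma asc_segment X Y Z : X ++ Y ++ Z = enum 'I_d ->
  Y = asc d (size X).+1 (size X + size Y).
Proof.
move=> e; have e' : map val (X ++ Y ++ Z) = iota 0 d by rewrite e val_enum_ord.
have sz : size X + (size Y + size Z) = d.
  by rewrite -!size_cat e size_enum_ord.
apply: (inj_map val_inj); rewrite val_asc //; last by lia.
move: e'; rewrite (_ : iota 0 d = iota 0 (size X + (size Y + size Z))); last by rewrite sz.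
rewrite !iotaD !map_cat => /eqP.
rewrite eqseq_cat ?size_map ?size_iota // eqseq_cat ?size_map ?size_iota //.
by case/and3P=> _ /eqP -> _; congr iota; lia.
Qed.

Lemma mem_full_uniq L x : uniq L -> size L = d -> x \in L.
Proof.
move=> uL sL; have [||_ ->] := @uniq_min_size _ L (enum 'I_d) uL; rewrite ?mem_enum //.
  by move=> y _; rewrite mem_enum.
by rewrite sL size_enum_ord.
Qed.

(** Each point is sent to its position in [L]; conjugation by [g] turns the blocks of a
    configuration into intervals. *)
Lemma relabel L : uniq L -> size L = d -> exists g : 'S_d, map g L = enum 'I_d.
Proof.
move=> uL sL; have inL x : x \in L := mem_full_uniq x uL sL.
have lt x : index x L < d by rewrite -[X in _ < X]sL index_mem.
have inj : injective (fun x => Ordinal (lt x)).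
  by move=> x y [] /(congr1 (nth x L)); rewrite !nth_index.
exists (perm inj); apply: (inj_map val_inj); rewrite val_enum_ord -map_comp.
apply: (@eq_from_nth _ 0); first by rewrite size_map size_iota.
move=> i; rewrite size_map => iL; have id' : i < d by rewrite -sL.
rewrite (nth_map (Ordinal id')) //= permE /= index_uniq // nth_iota //.
Qed.

Lemma neg_powersE (s : 'S_d) x a b :
  neg_powers s x a b = [seq (s^-1 ^+ j)%g x | j <- iota a (b.+1 - a)].
Proof. by apply: eq_map => j; rewrite expgVn. Qed.

Lemma map_iota_cat {T : eqType} (F : nat -> T) m n (X' Y' : seq T) :
  [seq F j | j <- iota m n] = X' ++ Y' ->
  X' = [seq F j | j <- iota m (size X')] /\
  Y' = [seq F j | j <- iota (m + size X') (size Y')].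
Proof.
move=> e; have sz : n = size X' + size Y' by rewrite -size_cat -e size_map size_iota.
move: e; rewrite sz iotaD map_cat.
move/eqP; rewrite eqseq_cat ?size_map ?size_iota // => /andP[/eqP e1 /eqP e2].
by rewrite e1 e2.
Qed.

End Labels.

(** * Configurations of lists and the explicit tuples *)

Section Configurations.

Context {d : nat}.
Implicit Types (a b p l x : 'I_d) (A B R G H X Y Z L : seq 'I_d).

(* The configuration of case (i), with s3 s4 = (p, A, B) and
   s1 = (l, rev R2, B2), s2 = (R2, l, A2), s3 = (p, rev R, B), s4 = (R, p, A). *)
Record single_config (e1 e2 e3 e4 k : nat) R p A B R2 l A2 B2 : Prop := SingleConfig {
  sc_uniq : uniq (R ++ p :: A ++ B ++ R2);
  sc_size : size (R ++ p :: A ++ B ++ R2) = d;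
  sc_uniq2 : uniq (l :: A2 ++ B2);
  sc_mem : l :: A2 ++ B2 =i p :: A ++ B;
  sc_inv : cyc (l :: A2 ++ B2) = (cyc (p :: A ++ B))^-1%g;
  sc_k : k = (size R).+1;
  sc_e1 : e1 = (size R2 + size B2).+1;
  sc_e2 : e2 = (size R2 + size A2).+1;
  sc_e3 : e3 = k + size B;
  sc_e4 : e4 = k + size A }.

(* The configuration of case (ii), with s1 = (a, G2, H1)^-1, s2 = (b, G1, H2)^-1,
   s3 = (b, rev Rb, H1, a, rev Ra, H2) and s4 = (Rb, b, G1, Ra, a, G2). *)
Record double_config (e1 e2 e3 e4 k m : nat) Rb b G1 Ra a G2 H1 H2 : Prop := DoubleConfig {
  dc_uniq : uniq (Rb ++ b :: G1 ++ Ra ++ a :: G2 ++ H1 ++ H2);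
  dc_size : size (Rb ++ b :: G1 ++ Ra ++ a :: G2 ++ H1 ++ H2) = d;
  dc_k : k = (size Rb).+1;
  dc_m : m = (size Rb + size G1 + size Ra).+2;
  dc_e1 : e1 = (size G2 + size H1).+1;
  dc_e2 : e2 = (size G1 + size H2).+1;
  dc_e3 : e3 = (size Rb + size H1 + size Ra + size H2).+2;
  dc_e4 : e4 = m + size G2 }.

Lemma sc_size2 e1 e2 e3 e4 k R p A B R2 l A2 B2 :
  single_config e1 e2 e3 e4 k R p A B R2 l A2 B2 -> size A2 + size B2 = size A + size B.
Proof.
case=> u _ u2 me _ _ _ _ _ _.
have u' : uniq (p :: A ++ B) by uniq_by_count.
by have := eq_card me; rewrite !(card_uniqP _) //= !size_cat => -[].
Qed.

Lemma sc_uniq12 e1 e2 e3 e4 k R p A B R2 l A2 B2 :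
  single_config e1 e2 e3 e4 k R p A B R2 l A2 B2 -> uniq (R2 ++ l :: A2 ++ B2).
Proof.
case=> u _ u2 me _ _ _ _ _ _.
have uR : uniq R2 by uniq_by_count.
rewrite cat_uniq uR u2 andbT; apply/hasPn => x; rewrite me => xN.
have c2 : 0 < count_mem x (p :: A ++ B) by rewrite -mem_count.
apply: contraTN u => xR; have c1 : 0 < count_mem x R2 by rewrite -mem_count.
by apply/negP => /uniq_count/(_ x); move: c1 c2; count_lia.
Qed.

Lemma closed_cyc L (S : {set 'I_d}) : uniq L ->
  (forall u, u \in S -> cyc L u \in S) ->
  forall x, x \in S -> x \in L -> {subset L <= S}.
Proof. by move=> uL h x xS; apply: fcycle_closed h xS (fcycle_cyc uL). Qed.

Lemma sc_uniqs e1 e2 e3 e4 k R p A B R2 l A2 B2 :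
  single_config e1 e2 e3 e4 k R p A B R2 l A2 B2 ->
  [/\ uniq (l :: rev R2 ++ B2), uniq (R2 ++ l :: A2), uniq (p :: rev R ++ B) & uniq (R ++ p :: A)].
Proof.
move=> sc; have u12 := sc_uniq12 sc; case: sc => u _ _ _ _ _ _ _ _ _.
by split; uniq_by_count.
Qed.

Lemma sc_sizes e1 e2 e3 e4 k R p A B R2 l A2 B2 :
  single_config e1 e2 e3 e4 k R p A B R2 l A2 B2 ->
  [/\ size (l :: rev R2 ++ B2) = e1, size (R2 ++ l :: A2) = e2,
      size (p :: rev R ++ B) = e3 & size (R ++ p :: A) = e4].
Proof.
case=> _ _ _ _ _ -> -> -> -> ->.
by rewrite /= !size_cat /= !size_rev !addnS !addSn.
Qed.

Lemma dc_uniqs e1 e2 e3 e4 k m Rb b G1 Ra a G2 H1 H2 :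
  double_config e1 e2 e3 e4 k m Rb b G1 Ra a G2 H1 H2 ->
  [/\ uniq (rev (a :: G2 ++ H1)), uniq (rev (b :: G1 ++ H2)),
      uniq (b :: rev Rb ++ H1 ++ a :: rev Ra ++ H2)
    & uniq (Rb ++ b :: G1 ++ Ra ++ a :: G2)].
Proof. by case=> u _ _ _ _ _ _ _; split; uniq_by_count. Qed.

Lemma dc_sizes e1 e2 e3 e4 k m Rb b G1 Ra a G2 H1 H2 :
  double_config e1 e2 e3 e4 k m Rb b G1 Ra a G2 H1 H2 ->
  [/\ size (rev (a :: G2 ++ H1)) = e1, size (rev (b :: G1 ++ H2)) = e2,
      size (b :: rev Rb ++ H1 ++ a :: rev Ra ++ H2) = e3
    & size (Rb ++ b :: G1 ++ Ra ++ a :: G2) = e4].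
Proof.
case=> _ _ _ -> -> -> -> ->; repeat progress rewrite /= ?(size_cat, size_rev).
by split; clear; lia.
Qed.

Lemma single_hurwitz4 e1 e2 e3 e4 k R p A B R2 l A2 B2 :
  single_config e1 e2 e3 e4 k R p A B R2 l A2 B2 ->
  hurwitz4 e1 e2 e3 e4 (cyc (l :: rev R2 ++ B2)) (cyc (R2 ++ l :: A2))
                       (cyc (p :: rev R ++ B)) (cyc (R ++ p :: A)).
Proof.
move=> sc; have u12 := sc_uniq12 sc; have [u1 u2' u3 u4] := sc_uniqs sc.
have [z1 z2 z3 z4] := sc_sizes sc; case: sc => u sL u2 me inv _ _ _ _ _.
split; [by exists (l :: rev R2 ++ B2)|by exists (R2 ++ l :: A2)
       |by exists (p :: rev R ++ B)|by exists (R ++ p :: A)| |].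
- rewrite !compp_cyc_single //; last by uniq_by_count.
  by rewrite inv /compp mulgV.
move=> S /set0Pn[x xS] /(closed_cyc u1) h1 /(closed_cyc u2') h2 /(closed_cyc u3) h3 /(closed_cyc u4) h4.
have pS : p \in S.
  have inN y : y \in S -> y \in R ++ p :: A ++ B -> p \in S.
    move=> yS; rewrite mem_cat inE mem_cat => yL.
    have [y4|y4] := boolP (y \in R ++ p :: A).
      by apply: (h4 _ yS y4); rewrite mem_cat mem_head orbT.
    apply: (h3 _ yS); last by rewrite mem_head.
    move: y4 yL; rewrite mem_cat !inE mem_cat => /norP[/negPf-> /norP[/negPf-> /negPf->]] /= ->.
    by rewrite !orbT.
  have := mem_full_uniq x u sL; rewrite (_ : _ ++ _ = (R ++ p :: A ++ B) ++ R2); last by rewrite -!catA /= -!catA.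
  rewrite mem_cat => /orP[/(inN _ xS)//|xR].
  have lS : l \in S by apply: (h2 _ xS); rewrite mem_cat ?xR // mem_head orbT.
  by apply: (inN _ lS); rewrite mem_cat -me mem_head orbT.
have S4 : {subset R ++ p :: A <= S} by apply: (h4 _ pS); rewrite mem_cat mem_head orbT.
have S3 : {subset p :: rev R ++ B <= S} by apply: (h3 _ pS); rewrite mem_head.
have S34 y : y \in R ++ p :: A ++ B -> y \in S.
  rewrite (_ : _ ++ _ = (R ++ p :: A) ++ B); last by rewrite -!catA.
  rewrite mem_cat => /orP[/S4//|yB]; apply: S3; by rewrite inE mem_cat yB !orbT.
have lS : l \in S by apply: S34; rewrite mem_cat -me mem_head orbT.
apply/setP => y; rewrite in_setT; have := mem_full_uniq y u sL.
rewrite (_ : _ ++ _ = (R ++ p :: A ++ B) ++ R2); last by rewrite -!catA /= -!catA.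
rewrite mem_cat => /orP[/S34//|yR]; apply: (h2 _ lS); rewrite mem_cat ?yR //.
by rewrite mem_head orbT.
Qed.

(** The lists of the third and fourth cycles together contain every point and share [b], whence
    transitivity; the product comes from [compp_cyc_double]. *)
Lemma double_hurwitz4 e1 e2 e3 e4 k m Rb b G1 Ra a G2 H1 H2 :
  double_config e1 e2 e3 e4 k m Rb b G1 Ra a G2 H1 H2 ->
  hurwitz4 e1 e2 e3 e4 (cyc (rev (a :: G2 ++ H1))) (cyc (rev (b :: G1 ++ H2)))
    (cyc (b :: rev Rb ++ H1 ++ a :: rev Ra ++ H2)) (cyc (Rb ++ b :: G1 ++ Ra ++ a :: G2)).
Proof.
move=> dc; have [u1 u2 u3 u4] := dc_uniqs dc; have [z1 z2 z3 z4] := dc_sizes dc.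
case: dc => u sL _ _ _ _ _ _.
split; [by exists (rev (a :: G2 ++ H1))|by exists (rev (b :: G1 ++ H2))
       |by exists (b :: rev Rb ++ H1 ++ a :: rev Ra ++ H2)
       |by exists (Rb ++ b :: G1 ++ Ra ++ a :: G2)| |].
- by rewrite !rev_uniq in u1 u2; rewrite compp_cyc_double // !cyc_rev // /compp -invMg mulgV.
move=> S /set0Pn[x xS] _ _ /(closed_cyc u3) h3 /(closed_cyc u4) h4.
have cover y : (y \in b :: rev Rb ++ H1 ++ a :: rev Ra ++ H2) || (y \in Rb ++ b :: G1 ++ Ra ++ a :: G2).
  have := mem_full_uniq y u sL; rewrite !(mem_cat, inE).
  by do !case/orP; move=> ->; rewrite ?mem_rev ?orbT //.
have bS : b \in S.
  case/orP: (cover x) => [/(h3 _ xS)|/(h4 _ xS)]; apply.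
    exact: mem_head.
  by rewrite mem_cat mem_head orbT.
apply/setP => y; rewrite in_setT; case/orP: (cover y) => [|].
  by apply: (h3 _ bS); rewrite mem_head.
by apply: (h4 _ bS); rewrite mem_cat mem_head orbT.
Qed.

Lemma segmentE X Y Z i j : X ++ Y ++ Z = enum 'I_d ->
  i = (size X).+1 -> j = size X + size Y -> asc d i j = Y.
Proof. by move=> e -> ->; rewrite -(asc_segment e). Qed.

Lemma single_canonical e1 e2 e3 e4 k R p A B R2 l A2 B2 :
  single_config e1 e2 e3 e4 k R p A B R2 l A2 B2 ->
  R ++ p :: A ++ B ++ R2 = enum 'I_d ->
  factorization_single e1 e3 e4 k l =
    [tuple cyc (l :: rev R2 ++ B2); cyc (R2 ++ l :: A2);
           cyc (p :: rev R ++ B); cyc (R ++ p :: A)]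
  /\ sigma d e3 e4 k = cyc (p :: A ++ B).
Proof.
move=> sc e; have s2 := sc_size2 sc; have u12 := sc_uniq12 sc; case: sc => u sL u2 me inv ek ee1 ee2 ee3 ee4.
have sd : size R + size A + size B + size R2 + 1 = d.
  by rewrite -[RHS]sL; repeat progress rewrite /= ?size_cat; lia.
have esg : sigma d e3 e4 k = cyc (p :: A ++ B).
  rewrite /sigma (@segmentE R (p :: A ++ B) R2) ?e //; first by cat_norm.
  by size_lia.
split=> //; rewrite /factorization_single esg.
have up : uniq (p :: A ++ B) by uniq_by_count.
(* The negative powers of sigma applied to [l] run through [l], [A2], [B2] and return to [l].
   Cutting after [A2], whose length is d + 1 - k - e1, gives the two runs of powers, the second one
   ending with this return. *)
have pl : path (frel (cyc (p :: A ++ B))^-1%g) l ((A2 ++ B2) ++ [:: l]).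
  by rewrite -inv cats1; apply: (fcycle_cyc u2).
have it := fpath_iter pl.
have [eA eB] : neg_powers (cyc (p :: A ++ B)) l 0 (d + 1 - k - e1) = l :: A2
   /\ neg_powers (cyc (p :: A ++ B)) l (d + 2 - k - e1) (e3 + e4 + 1 - 2 * k) = B2 ++ [:: l].
  have [] := @map_iota_cat _ (fun j => ((cyc (p :: A ++ B))^-1 ^+ j)%g l) 0
    (size ((A2 ++ B2) ++ [:: l])).+1 (l :: A2) (B2 ++ [:: l]).
    by rewrite -it /= -catA.
  move=> e1' e2'; rewrite !neg_powersE; split; [rewrite [RHS]e1' | rewrite [RHS]e2'];
    by congr map; congr iota; size_lia.
rewrite eA eB.
have -> : asc d 1 e4 = R ++ p :: A.
  by apply: (@segmentE [::] _ (B ++ R2)) => //=; [cat_norm|size_lia].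
have -> : desc d k 1 ++ asc d (e4 + 1) (e3 + e4 - k) = p :: rev R ++ B.
  rewrite /desc (@segmentE [::] (R ++ [:: p]) (A ++ B ++ R2)) //; [|by cat_norm|by size_lia].
  rewrite (@segmentE (R ++ p :: A) B R2) //; [|by cat_norm|by size_lia|by size_lia].
  by rewrite rev_cat.
have eR : asc d (e3 + e4 + 1 - k) d = R2.
  by apply: (@segmentE (R ++ p :: A ++ B) R2 [::]) => //; [rewrite cats0; cat_norm|size_lia|size_lia].
rewrite /desc eR; congr [tuple _; _; _; _].
(* The explicit first cycle ends with [l], the configuration starts there: a rotation. *)
by rewrite catA (@cyc_catC _ _ [:: l]) //; uniq_by_count.
Qed.

Lemma double_canonical e1 e2 e3 e4 k m Rb b G1 Ra a G2 H1 H2 :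
  double_config e1 e2 e3 e4 k m Rb b G1 Ra a G2 H1 H2 ->
  Rb ++ b :: G1 ++ Ra ++ a :: G2 ++ H1 ++ H2 = enum 'I_d ->
  factorization_double d e1 e3 e4 k m =
    [tuple cyc (rev (a :: G2 ++ H1)); cyc (rev (b :: G1 ++ H2));
       cyc (b :: rev Rb ++ H1 ++ a :: rev Ra ++ H2);
       cyc (Rb ++ b :: G1 ++ Ra ++ a :: G2)].
Proof.
case=> u sL ek em ee1 ee2 ee3 ee4 e; rewrite /factorization_double.
have sd : size Rb + size G1 + size Ra + size G2 + size H1 + size H2 + 2 = d.
  by rewrite -[RHS]sL; repeat progress rewrite /= ?size_cat; lia.
have -> : asc d 1 e4 = Rb ++ b :: G1 ++ Ra ++ a :: G2.
  by apply: (@segmentE [::] _ (H1 ++ H2)) => //=; [cat_norm|size_lia].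
rewrite /desc.
rewrite (@segmentE (Rb ++ b :: G1 ++ Ra) (a :: G2 ++ H1) H2); [|by cat_norm|by size_lia|by size_lia].
rewrite (@segmentE (Rb ++ b :: G1 ++ Ra ++ a :: G2 ++ H1) H2 [::]);
  [|by rewrite cats0; cat_norm|by size_lia|by size_lia].
rewrite (@segmentE Rb (b :: G1) (Ra ++ a :: G2 ++ H1 ++ H2)); [|by cat_norm|by size_lia|by size_lia].
rewrite (@segmentE [::] (Rb ++ [:: b]) (G1 ++ Ra ++ a :: G2 ++ H1 ++ H2)); [|by cat_norm|by size_lia|by size_lia].
rewrite (@segmentE (Rb ++ b :: G1 ++ Ra ++ a :: G2) H1 H2); [|by cat_norm|by size_lia|by size_lia].
rewrite (@segmentE (Rb ++ b :: G1) (Ra ++ [:: a]) (G2 ++ H1 ++ H2)); [|by cat_norm|by size_lia|by size_lia].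
by rewrite -rev_cat !rev_cat /= -?catA.
Qed.

End Configurations.

Lemma hurwitz_equiv4P d (s1 s2 s3 s4 t1 t2 t3 t4 : 'S_d) :
  reflect (exists g : 'S_d, [/\ t1 = s1 ^ g, t2 = s2 ^ g, t3 = s3 ^ g & t4 = s4 ^ g])%g
    (hurwitz_equiv [tuple s1; s2; s3; s4] [tuple t1; t2; t3; t4]).
Proof.
have e g := @forall_tnth4 _ _ (fun t s : 'S_d => t == (s ^ g)%g) t1 t2 t3 t4 s1 s2 s3 s4.
apply: (iffP existsP) => -[g]; rewrite ?e => h; exists g; rewrite ?e.
  by case/and4P: h => /eqP-> /eqP-> /eqP-> /eqP->.
by case: h => -> -> -> ->; rewrite !eqxx.
Qed.

Lemma cat_split {T : Type} n (L : seq T) : n <= size L ->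
  exists X Y, L = X ++ Y /\ size X = n.
Proof. by move=> nL; exists (take n L), (drop n L); rewrite cat_take_drop size_takel. Qed.

(** On [X] the product agrees with [cyc X], so the cycle of the product through [x] is [X] started
    at [x]; the product and [x] determine it. *)
Lemma disjoint_cycle_eq {T : finType} (X Y X' Y' : seq T) (x : T) :
  uniq (X ++ Y) -> uniq (X' ++ Y') ->
  compp (cyc X) (cyc Y) = compp (cyc X') (cyc Y') -> x \in X -> x \in X' ->
  cyc X = cyc X' /\ size X = size X'.
Proof.
move=> u u' e xX xX'.
have key (Z W : seq T) : uniq (Z ++ W) -> x \in Z ->
    exists Q, [/\ uniq (x :: Q), cyc Z = cyc (x :: Q), size (x :: Q) = size Z
                & fcycle (compp (cyc Z) (cyc W)) (x :: Q)].
  rewrite cat_uniq => /and3P[uZ /hasPn ZW _] xZ.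
  have [Q [uQ eQ mQ sQ _]] := rot_cyc uZ xZ; exists Q; split=> //.
  have := fcycle_cyc uQ; rewrite -eQ.
  apply: sub_in_cycle (allss _) => y z /=; rewrite mQ => uX _ /eqP <-.
  by rewrite comppE (@cyc_out _ W) //; apply/negP => /ZW; rewrite /= uX.
have [Q [uQ eX sX fQ]] := key _ _ u xX; have [Q' [uQ' eX' sX' fQ']] := key _ _ u' xX'.
by rewrite -e in fQ'; rewrite eX eX' -sX -sX' (fcycle_cons_inj uQ uQ' fQ fQ').
Qed.

(** * Admissible parameters and existence of the normal form *)

Section Existence.

Context {d : nat}.
Implicit Types (a b p l x : 'I_d) (A B R G H X Y Z L : seq 'I_d) (g : 'S_d).

Lemma single_config_map g e1 e2 e3 e4 k R p A B R2 l A2 B2 :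
  single_config e1 e2 e3 e4 k R p A B R2 l A2 B2 ->
  single_config e1 e2 e3 e4 k (map g R) (g p) (map g A) (map g B)
    (map g R2) (g l) (map g A2) (map g B2).
Proof.
case=> u sL u2 me inv ek ee1 ee2 ee3 ee4.
have ig : injective g by apply: perm_inj.
have e1' X : g p :: map g A ++ map g X = map g (p :: A ++ X) by rewrite /= map_cat.
have e2' : g l :: map g A2 ++ map g B2 = map g (l :: A2 ++ B2) by rewrite /= map_cat.
have up : uniq (p :: A ++ B) by uniq_by_count.
have eL : map g R ++ g p :: map g A ++ map g B ++ map g R2 = map g (R ++ p :: A ++ B ++ R2).
  by rewrite !map_cat /= !map_cat.
split; rewrite ?eL ?size_map ?e1' ?e2' ?map_inj_uniq //.
- move=> x; rewrite -[x](permKV g) !(mem_map ig); exact: me.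
- by rewrite -!cyc_conj // inv conjVg.
Qed.

Lemma double_config_map g e1 e2 e3 e4 k m Rb b G1 Ra a G2 H1 H2 :
  double_config e1 e2 e3 e4 k m Rb b G1 Ra a G2 H1 H2 ->
  double_config e1 e2 e3 e4 k m (map g Rb) (g b) (map g G1) (map g Ra) (g a)
    (map g G2) (map g H1) (map g H2).
Proof.
case=> u sL ek em ee1 ee2 ee3 ee4.
have ig : injective g by apply: perm_inj.
have eL : map g Rb ++ g b :: map g G1 ++ map g Ra ++ g a :: map g G2 ++ map g H1 ++ map g H2
  = map g (Rb ++ b :: G1 ++ Ra ++ a :: G2 ++ H1 ++ H2).
  by repeat progress rewrite /= ?map_cat.
by split; rewrite ?eL ?size_map ?map_inj_uniq.
Qed.

(** The block lengths are |R| = k - 1, |A| = e4 - k, |B| = e3 - k, |R2| = d + k - e3 - e4, |A2| = d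
    + 1 - k - e1 and |B2| = d + 1 - k - e2. The bounds on [k] make them nonnegative, the one for
    [A2] following from that for [B2] by e1 <= e2. *)
Lemma single_config_admissible e1 e2 e3 e4 k l :
  0 < e1 -> e1 <= e2 -> e3 <= e4 -> e4 <= d -> d < e3 + e4 ->
  e1 + e2 + (e3 + e4) = 2 * d + 2 -> admissible_single e2 e3 e4 k l ->
  exists R p A B R2 A2 B2, single_config e1 e2 e3 e4 k R p A B R2 l A2 B2
    /\ R ++ p :: A ++ B ++ R2 = enum 'I_d.
Proof.
move=> e1_0 e12 e34 e4d big sum /and3P[/andP[k1 k3] k2 kl].
have [n0 h0] : exists n, n.+1 = k by exists k.-1; lia.
have [n1 h1] : exists n, k + n = e4 by exists (e4 - k); lia.
have [n2 h2] : exists n, k + n = e3 by exists (e3 - k); lia.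
have [n3 h3] : exists n, n + e1 + k = d + 1 by exists (d + 1 - e1 - k); lia.
have {k1} k1 : e3 + e4 <= d + k by lia.
have {k2} k2 : k + e2 <= d + 1 by lia.
have ekk : e3 + e4 - k = k + (n1 + n2) by lia.
have size_enum := size_enum_ord d.
have [R [L1 [eL sR]]] : exists X Y : seq 'I_d, enum 'I_d = X ++ Y /\ size X = n0.
  by apply: cat_split; rewrite size_enum; lia.
have sL1 : n0 + size L1 = d by rewrite -sR -size_cat -eL size_enum_ord.
case: L1 eL sL1 => [|p L1] eL /= sL1; first by lia.
have [A [L2 [eL1 sA]]] : exists X Y : seq 'I_d, L1 = X ++ Y /\ size X = n1.
  by apply: cat_split; lia.
subst L1; rewrite !size_cat in sL1.
have [B [R2 [eL2 sB]]] : exists X Y : seq 'I_d, L2 = X ++ Y /\ size X = n2.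
  by apply: cat_split; lia.
subst L2; rewrite !size_cat in sL1.
have uL : uniq (R ++ p :: A ++ B ++ R2) by rewrite -eL enum_uniq.
have up : uniq (p :: A ++ B) by uniq_by_count.
have lp : l \in rev (p :: A ++ B).
  rewrite mem_rev -(@segmentE _ R (p :: A ++ B) R2 k (e3 + e4 - k)) ?mem_asc //.
  - by rewrite eL; cat_norm.
  - by rewrite sR h0.
  - by rewrite /= size_cat sR sA sB; lia.
(* Reversing (p, A, B) gives the inverse cycle; started at [l], it only remains to cut it into [A2]
   and [B2]. *)
have [Q [uQ eQ mQ sQ _]] := rot_cyc (etrans (rev_uniq _) up) lp.
have {}sQ : size (Q : seq 'I_d) = n1 + n2.
  by move: sQ; rewrite /= size_rev /= size_cat sA sB => -[].
have [A2 [B2 [defQ sA2]]] : exists X Y : seq 'I_d, Q = X ++ Y /\ size X = n3.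
  by apply: cat_split; rewrite sQ; lia.
subst Q; exists R, p, A, B, R2, A2, B2; split; last by rewrite eL.
have me : l :: A2 ++ B2 =i p :: A ++ B by move=> x; rewrite mQ mem_rev.
have inv : cyc (l :: A2 ++ B2) = (cyc (p :: A ++ B))^-1%g by rewrite -eQ cyc_rev.
rewrite size_cat in sQ.
have sL : size (R ++ p :: A ++ B ++ R2) = d by rewrite -eL size_enum_ord.
by split=> //; lia.
Qed.

(** The block lengths are |Rb| = k - 1, |G1| = m + d - e3 - e4, |Ra| = e3 + e4 - d - k - 1, |G2| =
    e4 - m, |H1| = m + e1 - 1 - e4 and |H2| = d + 1 - m - e1. All but that of [G1] are bounded
    directly by admissibility; for [G1] one uses m >= e4 - e1 + 1 and e1 + e3 <= d + 1, a
    consequence of the ordering. *)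
Lemma double_config_admissible e1 e2 e3 e4 k m :
  0 < e1 -> e1 <= e2 -> e2 <= e3 -> e3 <= e4 -> e4 <= d -> d < e3 + e4 ->
  e1 + e2 + (e3 + e4) = 2 * d + 2 -> admissible_double d e1 e3 e4 k m ->
  exists Rb b G1 Ra a G2 H1 H2, double_config e1 e2 e3 e4 k m Rb b G1 Ra a G2 H1 H2
    /\ Rb ++ b :: G1 ++ Ra ++ a :: G2 ++ H1 ++ H2 = enum 'I_d.
Proof.
move=> e1_0 e12 e23 e34 e4d big sum /and3P[/andP[k1 k3] /andP[m1 m2] m4].
have [n0 h0] : exists n, n.+1 = k by exists k.-1; lia.
have [n1 h1] : exists n, n + (e3 + e4) = m + d by exists (m + d - e3 - e4); lia.
have [n2 h2] : exists n, n + d + k + 1 = e3 + e4 by exists (e3 + e4 - d - k - 1); lia.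
have [n3 h3] : exists n, m + n = e4 by exists (e4 - m); lia.
have [n4 h4] : exists n, n + e4 + 1 = m + e1 by exists (m + e1 - 1 - e4); lia.
have {m2} m2 : m + e1 <= d + 1 by lia.
move=> {k1 k3 m1}; have size_enum := size_enum_ord d.
have [Rb [L1 [eL sRb]]] : exists X Y : seq 'I_d, enum 'I_d = X ++ Y /\ size X = n0.
  by apply: cat_split; rewrite size_enum; lia.
have sL1 : n0 + size L1 = d by rewrite -sRb -size_cat -eL size_enum_ord.
case: L1 eL sL1 => [|b L1] eL /= sL1; first by lia.
have [G1 [L2 [eL1 sG1]]] : exists X Y : seq 'I_d, L1 = X ++ Y /\ size X = n1.
  by apply: cat_split; lia.
subst L1; rewrite size_cat in sL1.
have [Ra [L3 [eL2 sRa]]] : exists X Y : seq 'I_d, L2 = X ++ Y /\ size X = n2.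
  by apply: cat_split; lia.
subst L2; rewrite size_cat in sL1.
case: L3 eL sL1 => [|a L3] eL /= sL1; first by lia.
have [G2 [L4 [eL3 sG2]]] : exists X Y : seq 'I_d, L3 = X ++ Y /\ size X = n3.
  by apply: cat_split; lia.
subst L3; rewrite size_cat in sL1.
have [H1 [H2 [eL4 sH1]]] : exists X Y : seq 'I_d, L4 = X ++ Y /\ size X = n4.
  by apply: cat_split; lia.
subst L4; rewrite size_cat in sL1.
exists Rb, b, G1, Ra, a, G2, H1, H2; split; last by rewrite eL.
have uL : uniq (Rb ++ b :: G1 ++ Ra ++ a :: G2 ++ H1 ++ H2) by rewrite -eL enum_uniq.
have sL : size (Rb ++ b :: G1 ++ Ra ++ a :: G2 ++ H1 ++ H2) = d by rewrite -eL size_enum_ord.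
by split=> //; lia.
Qed.

Lemma single_exists e1 e2 e3 e4 (s1 s2 s3 s4 : 'S_d) :
  1 < e1 -> 1 < e2 -> 1 < e3 -> 1 < e4 -> d < e3 + e4 -> e1 + e2 + (e3 + e4) = 2 * d + 2 ->
  hurwitz4 e1 e2 e3 e4 s1 s2 s3 s4 -> (exists j, (s1 j != j) && (s2 j != j)) ->
  exists k l, admissible_single e2 e3 e4 k l /\
    hurwitz_equiv [tuple s1; s2; s3; s4] (factorization_single e1 e3 e4 k l).
Proof.
move=> n1 n2 n3 n4 big sum [] [c1 [u1 z1 d1]] [c2 [u2 z2 d2]] [c3 [u3 z3 d3]] [c4 [u4 z4 d4]].
rewrite {}d1 {}d2 {}d3 {}d4 => prod1 conn [j /andP[j1 j2]].
have {}j1 : j \in c1 by apply: contraNT j1 => /cyc_out->.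
have {}j2 : j \in c2 by apply: contraNT j2 => /cyc_out->.
rewrite -z1 -z2 -z3 -z4 in n1 n2 n3 n4 big sum *.
(* Disjoint supports would need e3 + e4 <= d points. *)
have [i] : exists i, i \in [set x in c3] :&: [set x in c4].
  apply/set0Pn; rewrite -card_gt0 lt0n; apply: contraTneq big => i0.
  have := cardsUI [set x in c3] [set x in c4]; rewrite {}i0 addn0.
  rewrite [#|[set x in c3]|]cardsE [#|[set x in c4]|]cardsE !(card_uniqP _) // => <-.
  by rewrite -leqNgt -[X in _ <= X]card_ord max_card.
rewrite !inE => /andP[i3 i4].
have [p [l [pD e34 lE e12]]] := inter_single u1 u2 u3 u4 n1 n2 n3 n4 sum prod1 conn i3 i4 j1 j2.
have f12 := fixed12 u3 u4 n1 n3 n4 prod1 conn.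
have f34 := fixed34 u1 u2 n1 n2 prod1 conn.
set O' := [set x in c1] :|: [set x in c2] in pD e34 f12.
set O := [set x in c3] :|: [set x in c4] in lE e12 f34.
have [|||R [A [B [uL mR [q4 sz4 m4] [q3 sz3 m3]]]]] := @single_lists _ c3 c4 (~: O') u3 u4 _ p.
- by move=> u; rewrite inE => /f12.
- by rewrite inE negbK.
- by move=> u; have /setP/(_ u) := e34; rewrite !inE.
have [|||R2 [A2 [B2 [uL2 mR2 [q2 sz2 m2] [q1 sz1 m1]]]]] := @single_lists _ c1 c2 (~: O) u1 u2 _ l.
- by move=> u; rewrite inE => /f34.
- by rewrite inE negbK.
- by move=> u; have /setP/(_ u) := e12; rewrite !inE.
have mO x : (x \in R ++ p :: A ++ B) = (x \in O).
  rewrite !inE -m3 -m4 !(mem_cat, inE, mem_rev).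
  by case: (x \in R) (x == p) (x \in A) (x \in B) => [] [] [] [].
have mO' x : (x \in R2 ++ l :: A2 ++ B2) = (x \in O').
  rewrite !inE -m1 -m2 !(mem_cat, inE, mem_rev).
  by case: (x \in R2) (x == l) (x \in A2) (x \in B2) => [] [] [] [].
have mem_cat_uniq X Y x : uniq (X ++ Y) -> (x \in Y) = (x \in X ++ Y) && (x \notin X).
  rewrite cat_uniq mem_cat => /and3P[_ /hasPn h _].
  by case: (boolP (x \in Y)) => [/h/negPf /= ->|]; rewrite ?orbF //; case: (x \in X).
(* Removing [R], the complement of O', from O and [R2], the complement of O, from O' leaves the same
   set, the intersection of O and O'. *)
have me : l :: A2 ++ B2 =i p :: A ++ B.
  move=> x; rewrite (mem_cat_uniq R2) // (mem_cat_uniq R (p :: A ++ B)) // mO mO'.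
  by rewrite mR mR2 !in_setC !negbK andbC.
have uLL : uniq (R ++ p :: A ++ B ++ R2).
  have u : uniq ((R ++ p :: A ++ B) ++ R2).
    rewrite cat_uniq uL; have uR2 : uniq R2 by uniq_by_count.
    by rewrite uR2 andbT; apply/hasPn => x; rewrite mR2 inE => xO; rewrite /= mO.
  by move: u; rewrite -!catA /= -catA.
have sL : size (R ++ p :: A ++ B ++ R2) = d.
  rewrite -(card_uniqP uLL) -[RHS]card_ord; apply: eq_card => x; rewrite [RHS]inE.
  rewrite (_ : _ ++ _ = (R ++ p :: A ++ B) ++ R2); last by rewrite -!catA /= -!catA.
  by rewrite mem_cat mO mR2 in_setC orbN.
have inv : cyc (l :: A2 ++ B2) = (cyc (p :: A ++ B))^-1%g.
  move: prod1; rewrite q1 q2 q3 q4 !compp_cyc_single // {1}/compp => e.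
  by rewrite -[LHS](mulKg (cyc (p :: A ++ B))) e mulg1.
have [e1' e2' e3' e4'] : [/\ size c1 = (size R2 + size B2).+1, size c2 = (size R2 + size A2).+1,
    size c3 = (size R).+1 + size B & size c4 = (size R).+1 + size A].
  by rewrite -sz1 -sz2 -sz3 -sz4 /= !size_cat /= !size_rev !addnS addSn.
have sc : single_config (size c1) (size c2) (size c3) (size c4) (size R).+1 R p A B R2 l A2 B2.
  by split => //; uniq_by_count.
have ss := sc_size2 sc.
have [g eg] := relabel uLL sL.
have sg := single_config_map g sc.
have full : map g R ++ g p :: map g A ++ map g B ++ map g R2 = enum 'I_d.
  by rewrite -eg !map_cat /= !map_cat.
have [fE _] := single_canonical sg full.
exists (size R).+1, (g l); split; last first.
  rewrite fE {fE}.
  apply/hurwitz_equiv4P; exists g; rewrite q1 q2 q3 q4 !cyc_conj; [|uniq_by_count..].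
  by rewrite -!map_rev; split; rewrite ?map_cat /= ?map_cat.
have dd : size R + size A + size B + size R2 + 1 = d.
  by rewrite -[RHS]sL; repeat progress rewrite /= ?size_cat; clear; lia.
have k34 : (size R).+1 <= (g l).+1 <= (size R).+1 + size A + size B.
  rewrite -mem_asc (@segmentE _ (map g R) (map g (p :: A ++ B)) (map g R2)).
  - by rewrite mem_map; [rewrite -me mem_head|apply: perm_inj].
  - by rewrite -full /= map_cat -!catA.
  - by rewrite size_map.
  - by rewrite !size_map /= size_cat; clear; lia.
rewrite /admissible_single; move: dd e2' e3' e4' k34 ss.
move: (size R) (size A) (size B) (size R2) (size A2) (size B2) (size c2) (size c3) (size c4).
clear => r a b r2 a2 b2 z2 z3 z4 dd -> -> -> /andP[k1 k2] ss; apply/and3P; split; lia.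
Qed.

Lemma double_exists e1 e2 e3 e4 (s1 s2 s3 s4 : 'S_d) :
  1 < e1 -> 1 < e2 -> 1 < e3 -> 1 < e4 -> d < e3 + e4 -> e1 + e2 + (e3 + e4) = 2 * d + 2 ->
  hurwitz4 e1 e2 e3 e4 s1 s2 s3 s4 -> (forall j, (s1 j == j) || (s2 j == j)) ->
  exists k m, admissible_double d e1 e3 e4 k m /\
    hurwitz_equiv [tuple s1; s2; s3; s4] (factorization_double d e1 e3 e4 k m).
Proof.
move=> n1 n2 n3 n4 big sum [] [c1 [u1 z1 d1]] [c2 [u2 z2 d2]] [c3 [u3 z3 d3]] [c4 [u4 z4 d4]].
rewrite {}d1 {}d2 {}d3 {}d4 => prod1 conn dis.
rewrite -z1 -z2 -z3 -z4 in n1 n2 n3 n4 big sum *.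
have {}dis : [disjoint c1 & c2].
  rewrite disjoint_has; apply/hasPn => j j1; apply/negP => j2; have := dis j.
  by rewrite (negPf (cyc_neq u1 n1 j1)) (negPf (cyc_neq u2 n2 j2)).
have [a [b [a1 b2 OT e34]]] := inter_double u1 u2 u3 u4 n1 n2 n3 n4 sum prod1 conn big dis.
have f12 := fixed12 u3 u4 n1 n3 n4 prod1 conn.
set O' := [set x in c1] :|: [set x in c2] in e34 f12.
have a2 : a \notin c2 by rewrite (disjointFr dis a1).
have ab : a != b by apply: contraNneq a2 => ->.
have [||||Ra [Rb [G1 [G2 [H1 [H2 [uL mR [q4 sz4 m4] [q3 sz3 m3]]]]]]]] :=
    @double_lists _ c3 c4 (~: O') u3 u4 _ a b _ _ ab _.
- by move=> u; rewrite inE => /f12.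
- by rewrite !inE a1.
- by rewrite !inE b2 orbT.
- by move=> u; have /setP/(_ u) := e34; rewrite !inE.
have sL : size (Rb ++ b :: G1 ++ Ra ++ a :: G2 ++ H1 ++ H2) = d.
  rewrite -(card_uniqP uL) -[RHS]card_ord; apply: eq_card => x; rewrite [RHS]inE.
  have := in_setT x; rewrite -OT !inE -m3 -m4 !(mem_cat, inE, mem_rev).
  by do !case/orP; move=> ->; rewrite ?orbT.
have uab : uniq (rev (a :: G2 ++ H1) ++ rev (b :: G1 ++ H2)) by uniq_by_count.
have u12 : uniq (c1 ++ c2) by rewrite cat_uniq u1 u2 -disjoint_has disjoint_sym dis.
have inv : compp (cyc c1) (cyc c2) =
    compp (cyc (rev (a :: G2 ++ H1))) (cyc (rev (b :: G1 ++ H2))).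
  move: prod1; rewrite q3 q4 compp_cyc_double // {1}/compp => e.
  rewrite -[LHS](mulKg (compp (cyc (b :: G1 ++ H2)) (cyc (a :: G2 ++ H1)))) e mulg1.
  by rewrite !cyc_rev /compp ?invMg //; uniq_by_count.
(* Only the product of the first two cycles is known so far; the position of [a] and [b] tells which
   of its disjoint cycles is which. *)
have [q1 sz1] : cyc c1 = cyc (rev (a :: G2 ++ H1)) /\ size c1 = size (rev (a :: G2 ++ H1)).
  by apply: disjoint_cycle_eq u12 uab inv a1 _; rewrite mem_rev mem_head.
have [q2 sz2] : cyc c2 = cyc (rev (b :: G1 ++ H2)) /\ size c2 = size (rev (b :: G1 ++ H2)).
  apply: disjoint_cycle_eq b2 _; [by rewrite uniq_catC; exact: u12|by rewrite uniq_catC; exact: uab| |].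
    by rewrite -!(compp_cyc_disjointC u12, compp_cyc_disjointC uab).
  by rewrite mem_rev mem_head.
have [g eg] := relabel uL sL.
have dc : double_config (size c1) (size c2) (size c3) (size c4) (size Rb).+1
    (size Rb + size G1 + size Ra).+2 Rb b G1 Ra a G2 H1 H2.
  split=> //.
  - by rewrite sz1 size_rev /= size_cat.
  - by rewrite sz2 size_rev /= size_cat.
  - by rewrite -sz3; repeat progress rewrite /= ?(size_cat, size_rev); clear; lia.
  - by rewrite -sz4; repeat progress rewrite /= ?(size_cat, size_rev); clear; lia.
have sg := double_config_map g dc.
have full : map g Rb ++ g b :: map g G1 ++ map g Ra ++ g a :: map g G2 ++ map g H1 ++ map g H2
    = enum 'I_d.
  by rewrite -eg; repeat progress rewrite /= ?map_cat.
exists (size Rb).+1, (size Rb + size G1 + size Ra).+2; split; last first.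
  rewrite (double_canonical sg full); apply/hurwitz_equiv4P; exists g.
  rewrite q1 q2 q3 q4 !cyc_conj; [|uniq_by_count..].
  by split; repeat progress rewrite /= ?(map_rev, map_cat).
have dd : size Rb + size G1 + size Ra + size G2 + size H1 + size H2 + 2 = d.
  by rewrite -[RHS]sL; repeat progress rewrite /= ?size_cat; clear; lia.
case: dc => _ _ _ _ e1' e2' e3' e4'; rewrite /admissible_double; move: dd e1' e3' e4'.
move: (size Rb) (size G1) (size Ra) (size G2) (size H1) (size H2) (size c1) (size c3) (size c4).
clear => rb g1 ra g2 h1 h2 z1 z3 z4 dd -> -> ->; apply/and3P; split; lia.
Qed.

End Existence.

(** * Uniqueness of the parameters *)

Lemma mem_moved {T : finType} (c : seq T) (x : T) : uniq c -> 1 < size c ->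
  (x \in c) = (cyc c x != x).
Proof.
move=> uc sc; apply/idP/idP => [|]; first exact: cyc_neq.
by apply: contraNT => /cyc_out->.
Qed.

Lemma eq_mem_cyc {T : finType} (c c' : seq T) : uniq c -> 1 < size c -> uniq c' -> 1 < size c' ->
  cyc c = cyc c' -> c =i c'.
Proof. by move=> uc sc uc' sc' e x; rewrite !mem_moved // e. Qed.

Lemma eq_cat_index {T : eqType} (x : T) (X Y X' Y' : seq T) :
  X ++ x :: Y = X' ++ x :: Y' -> x \notin X -> x \notin X' -> size X = size X'.
Proof.
move=> e xX xX'; have := congr1 (index x) e.
by rewrite !index_cat (negPf xX) (negPf xX') /= eqxx !addn0.
Qed.

Section Uniqueness.

Context {d : nat}.
Implicit Types (a b p l x : 'I_d) (A B R G H X Y Z L : seq 'I_d) (g s : 'S_d).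

(** Supports are determined by the permutations, and [mems] recovers [p], [l] and the set of entries
    of [R] from them. The orders within the blocks then follow by reading the third and fourth
    cycles from [p]. *)
Lemma single_config_unique e1 e2 e3 e4 k R p A B R2 l A2 B2 k' R' p' A' B' R2' l' A2' B2' :
  1 < e1 -> 1 < e2 -> 1 < e3 -> 1 < e4 ->
  single_config e1 e2 e3 e4 k R p A B R2 l A2 B2 ->
  single_config e1 e2 e3 e4 k' R' p' A' B' R2' l' A2' B2' ->
  cyc (l :: rev R2 ++ B2) = cyc (l' :: rev R2' ++ B2') ->
  cyc (R2 ++ l :: A2) = cyc (R2' ++ l' :: A2') ->
  cyc (p :: rev R ++ B) = cyc (p' :: rev R' ++ B') ->
  cyc (R ++ p :: A) = cyc (R' ++ p' :: A') ->
  [/\ k = k', l = l', R = R' & p :: A ++ B = p' :: A' ++ B'].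
Proof.
move=> n1 n2 n3 n4 sc sc' q1 q2 q3 q4.
have mems e1' e2' e3' e4' kk RR pp AA BB RR2 ll AA2 BB2 :
    single_config e1' e2' e3' e4' kk RR pp AA BB RR2 ll AA2 BB2 -> forall x,
    [/\ [&& x \in RR ++ pp :: AA, x \in pp :: rev RR ++ BB
          & (x \in RR2 ++ ll :: AA2) || (x \in ll :: rev RR2 ++ BB2)] = (x == pp),
        [&& x \in RR2 ++ ll :: AA2, x \in ll :: rev RR2 ++ BB2
          & (x \in RR ++ pp :: AA) || (x \in pp :: rev RR ++ BB)] = (x == ll)
      & (x \in RR ++ pp :: AA) && (x \in pp :: rev RR ++ BB) = (x \in RR) || (x == pp)].
  case=> u sL u2 me _ _ _ _ _ _ x.
  have := mem_full_uniq x u sL; move: (me x); rewrite !mem_count.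
  move: (elimT (uniq_count _) u x) (elimT (uniq_count _) u2 x).
  rewrite ![x == _]eq_sym; repeat progress rewrite /= ?(count_cat, count_rev).
  move: (pp == x) (ll == x) => bp bl.
  move: (count _ RR) (count _ AA) (count _ BB) (count _ RR2) (count _ AA2) (count _ BB2).
  by clear; case: bp; case: bl => /= *; split; lia.
have [u1 u2 u3 u4] := sc_uniqs sc; have [u1' u2' u3' u4'] := sc_uniqs sc'.
have [z1 z2 z3 z4] := sc_sizes sc; have [z1' z2' z3' z4'] := sc_sizes sc'.
have m1 : l :: rev R2 ++ B2 =i l' :: rev R2' ++ B2' by apply: eq_mem_cyc; rewrite ?z1 ?z1'.
have m2 : R2 ++ l :: A2 =i R2' ++ l' :: A2' by apply: eq_mem_cyc; rewrite ?z2 ?z2'.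
have m3 : p :: rev R ++ B =i p' :: rev R' ++ B' by apply: eq_mem_cyc; rewrite ?z3 ?z3'.
have m4 : R ++ p :: A =i R' ++ p' :: A' by apply: eq_mem_cyc; rewrite ?z4 ?z4'.
have ep : p = p'.
  have [e _ _] := mems _ _ _ _ _ _ _ _ _ _ _ _ _ sc p'.
  have [e' _ _] := mems _ _ _ _ _ _ _ _ _ _ _ _ _ sc' p'.
  by move: e'; rewrite -m1 -m2 -m3 -m4 e eqxx => /eqP.
have el : l = l'.
  have [_ e _] := mems _ _ _ _ _ _ _ _ _ _ _ _ _ sc l'.
  have [_ e' _] := mems _ _ _ _ _ _ _ _ _ _ _ _ _ sc' l'.
  by move: e'; rewrite -m1 -m2 -m3 -m4 e eqxx => /eqP.
subst p' l'.
have sR : size R = size R'.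
  have mR : rcons R p =i rcons R' p.
    move=> x; rewrite !mem_rcons !inE.
    have [_ _ e] := mems _ _ _ _ _ _ _ _ _ _ _ _ _ sc x.
    have [_ _ e'] := mems _ _ _ _ _ _ _ _ _ _ _ _ _ sc' x.
    by move: e'; rewrite -m3 -m4 e orbC => ->; rewrite orbC.
  have uR : uniq (rcons R p) by rewrite -cats1; clear -u4; uniq_by_count.
  have uR' : uniq (rcons R' p) by rewrite -cats1; clear -u4'; uniq_by_count.
  by have := eq_card mR; rewrite !(card_uniqP _) // !size_rcons => -[].
have eAR : A ++ R = A' ++ R'.
  apply: (@fcycle_cons_inj _ (cyc (R ++ p :: A)) p); [uniq_by_count..| |].
    by rewrite (@cyc_catC _ R (p :: A)) //; apply: fcycle_cyc; uniq_by_count.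
  by rewrite q4 (@cyc_catC _ R' (p :: A')) //; apply: fcycle_cyc; uniq_by_count.
have eRB : rev R ++ B = rev R' ++ B'.
  apply: (@fcycle_cons_inj _ (cyc (p :: rev R ++ B)) p) => //; first exact: fcycle_cyc.
  by rewrite q3; apply: fcycle_cyc.
have sA : size A = size A' by have /eqP := congr1 size eAR; rewrite !size_cat sR eqn_add2r => /eqP.
move/eqP: eAR; rewrite eqseq_cat // => /andP[/eqP -> /eqP eR].
move/eqP: eRB; rewrite eqseq_cat ?size_rev // => /andP[_ /eqP ->].
by split=> //; rewrite (sc_k sc) (sc_k sc') sR.
Qed.

Lemma double_config_unique e1 e2 e3 e4 k m Rb b G1 Ra a G2 H1 H2
    k' m' Rb' b' G1' Ra' a' G2' H1' H2' :
  1 < e1 -> 1 < e2 -> 1 < e3 -> 1 < e4 ->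
  double_config e1 e2 e3 e4 k m Rb b G1 Ra a G2 H1 H2 ->
  double_config e1 e2 e3 e4 k' m' Rb' b' G1' Ra' a' G2' H1' H2' ->
  cyc (rev (a :: G2 ++ H1)) = cyc (rev (a' :: G2' ++ H1')) ->
  cyc (rev (b :: G1 ++ H2)) = cyc (rev (b' :: G1' ++ H2')) ->
  cyc (b :: rev Rb ++ H1 ++ a :: rev Ra ++ H2) =
    cyc (b' :: rev Rb' ++ H1' ++ a' :: rev Ra' ++ H2') ->
  cyc (Rb ++ b :: G1 ++ Ra ++ a :: G2) = cyc (Rb' ++ b' :: G1' ++ Ra' ++ a' :: G2') ->
  k = k' /\ m = m'.
Proof.
move=> n1 n2 n3 n4 dc dc' q1 q2 q3 q4.
have mems e1' e2' e3' e4' kk mm RRb bb GG1 RRa aa GG2 HH1 HH2 :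
    double_config e1' e2' e3' e4' kk mm RRb bb GG1 RRa aa GG2 HH1 HH2 -> forall x,
    [&& x \in RRb ++ bb :: GG1 ++ RRa ++ aa :: GG2,
        x \in bb :: rev RRb ++ HH1 ++ aa :: rev RRa ++ HH2
      & x \in rev (aa :: GG2 ++ HH1)] = (x == aa) /\
    [&& x \in RRb ++ bb :: GG1 ++ RRa ++ aa :: GG2,
        x \in bb :: rev RRb ++ HH1 ++ aa :: rev RRa ++ HH2
      & x \in rev (bb :: GG1 ++ HH2)] = (x == bb).
  case=> u _ _ _ _ _ _ _ x; rewrite !mem_count.
  move: (elimT (uniq_count _) u x).
  rewrite ![x == _]eq_sym; repeat progress rewrite /= ?(count_cat, count_rev).
  move: (aa == x) (bb == x) => ba bb'.
  move: (count _ RRa) (count _ RRb) (count _ GG1) (count _ GG2) (count _ HH1) (count _ HH2).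
  by clear; case: ba; case: bb' => /= *; split; lia.
have [u1 u2 u3 u4] := dc_uniqs dc; have [u1' u2' u3' u4'] := dc_uniqs dc'.
have [z1 z2 z3 z4] := dc_sizes dc; have [z1' z2' z3' z4'] := dc_sizes dc'.
have m1 : rev (a :: G2 ++ H1) =i rev (a' :: G2' ++ H1') by apply: eq_mem_cyc; rewrite ?z1 ?z1'.
have m2 : rev (b :: G1 ++ H2) =i rev (b' :: G1' ++ H2') by apply: eq_mem_cyc; rewrite ?z2 ?z2'.
have m3 := @eq_mem_cyc _ _ _ u3 _ u3' _ q3; have m4 := @eq_mem_cyc _ _ _ u4 _ u4' _ q4.
rewrite z3 z3' in m3; rewrite z4 z4' in m4; move: (m3 n3 n3) (m4 n4 n4) => {}m3 {}m4.
have ea : a = a'.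
  have [e _] := mems _ _ _ _ _ _ _ _ _ _ _ _ _ _ dc a'.
  have [e' _] := mems _ _ _ _ _ _ _ _ _ _ _ _ _ _ dc' a'.
  by move: e'; rewrite -m1 -m3 -m4 e eqxx => /eqP.
have eb : b = b'.
  have [_ e] := mems _ _ _ _ _ _ _ _ _ _ _ _ _ _ dc b'.
  have [_ e'] := mems _ _ _ _ _ _ _ _ _ _ _ _ _ _ dc' b'.
  by move: e'; rewrite -m2 -m3 -m4 e eqxx => /eqP.
subst a' b'.
have e4E : (G1 ++ Ra) ++ a :: G2 ++ Rb = (G1' ++ Ra') ++ a :: G2' ++ Rb'.
  apply: (@fcycle_cons_inj _ (cyc (Rb ++ b :: G1 ++ Ra ++ a :: G2)) b); [uniq_by_count..| |].
    rewrite (_ : cyc _ = cyc (b :: (G1 ++ Ra) ++ a :: G2 ++ Rb)).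
      by apply: fcycle_cyc; uniq_by_count.
    by rewrite (@cyc_catC _ Rb) //= -!catA.
  rewrite q4 (_ : cyc _ = cyc (b :: (G1' ++ Ra') ++ a :: G2' ++ Rb')).
    by apply: fcycle_cyc; uniq_by_count.
  by rewrite (@cyc_catC _ Rb') //= -!catA.
have e3E : (rev Rb ++ H1) ++ a :: rev Ra ++ H2 = (rev Rb' ++ H1') ++ a :: rev Ra' ++ H2'.
  apply: (@fcycle_cons_inj _ (cyc (b :: rev Rb ++ H1 ++ a :: rev Ra ++ H2)) b).
  - by rewrite -catA.
  - by rewrite -catA.
  - by rewrite -catA; apply: fcycle_cyc.
  - by rewrite q3 -catA; apply: fcycle_cyc.
have nota X Y : uniq (X ++ a :: Y) -> a \notin X.
  by apply: contraTN => aX; rewrite cat_uniq /= aX /= andbF.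
have s4 : size (G1 ++ Ra) = size (G1' ++ Ra').
  apply: (eq_cat_index e4E); first by apply: (nota _ (G2 ++ Rb)); clear -u4; uniq_by_count.
  by apply: (nota _ (G2' ++ Rb')); clear -u4'; uniq_by_count.
have s3 : size (rev Rb ++ H1) = size (rev Rb' ++ H1').
  apply: (eq_cat_index e3E); first by apply: (nota _ (rev Ra ++ H2)); clear -u3; uniq_by_count.
  by apply: (nota _ (rev Ra' ++ H2')); clear -u3'; uniq_by_count.
(* The position of [a] after [b] in the third and fourth cycles fixes |Rb| + |H1| and |G1| + |Ra|;
   with e4 and e1 this fixes the pairwise sums of |Rb|, |H1| and |G2|, hence each of these three
   lengths. *)
move: s3 s4; rewrite !size_cat !size_rev (dc_k dc) (dc_k dc') (dc_m dc) (dc_m dc').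
have := etrans (esym (dc_e1 dc)) (dc_e1 dc'); have := etrans (esym (dc_e4 dc)) (dc_e4 dc').
rewrite (dc_m dc) (dc_m dc').
move: (size Rb) (size Rb') (size G1) (size G1') (size Ra) (size Ra') (size G2) (size G2').
by move: (size H1) (size H1'); clear => *; lia.
Qed.

End Uniqueness.

Section CycleTypes.

Context {T : finType}.
Implicit Types (s g : {perm T}).

Lemma trivial_or_single_cycleJ s g :
  trivial_or_single_cycle s -> trivial_or_single_cycle (s ^ g)%g.
Proof.
case=> [->|[n n2 /is_cycleP[c [uc sc ->]]]]; [left|right]; first exact: conj1g.
exists n => //; apply/is_cycleP; exists (map g c); rewrite size_map cyc_conj //.
by rewrite map_inj_uniq //; apply: perm_inj.
Qed.

Lemma two_disjoint_cyclesJ s g : two_disjoint_cycles s -> two_disjoint_cycles (s ^ g)%g.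
Proof.
case=> c1 [c2 [n1 n2 u ->]]; exists (map g c1), (map g c2).
have [u1 u2] : uniq c1 /\ uniq c2 by move: u; rewrite cat_uniq => /and3P[].
by rewrite !size_map -map_cat comppJ !cyc_conj // map_inj_uniq //; apply: perm_inj.
Qed.

(** A single cycle would have to contain moved points of both [c1] and [c2], although [c1] is
    already stable under [s]. *)
Lemma single_not_double s : trivial_or_single_cycle s -> two_disjoint_cycles s -> False.
Proof.
move=> h [c1 [c2 [n1 n2 u e]]].
have : uniq (c1 ++ c2) := u; rewrite cat_uniq => /and3P[u1 /hasPn dis u2].
have s1 x : x \in c1 -> s x = cyc c1 x.
  by move=> x1; rewrite e comppE (@cyc_out _ c2) //; apply/negP => /dis; rewrite /= x1.
have s2 x : x \in c2 -> s x = cyc c2 x.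
  by move=> x2; rewrite e comppE cyc_out // ; apply: dis; rewrite mem_cyc.
have [x x1] : exists x, x \in c1 by case: (c1) n1 => // x c _; exists x; apply: mem_head.
have [y y2] : exists y, y \in c2 by case: (c2) n2 => // y c _; exists y; apply: mem_head.
have sx : s x != x by rewrite s1 // -mem_moved.
have sy : s y != y by rewrite s2 // -mem_moved.
case: h => [s_1|[n _ /is_cycleP[c [uc _ sE]]]]; first by rewrite s_1 perm1 eqxx in sx.
have xc : x \in c by apply: contraNT sx => xc; rewrite sE cyc_out.
have yc : y \in c by apply: contraNT sy => yc; rewrite sE cyc_out.
have sub : {subset c <= [set z in c1]}.
  apply: (@fcycle_closed _ s _ x) => //; rewrite ?inE //.
    by move=> z; rewrite !inE => z1; rewrite s1 ?mem_cyc.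
  by rewrite sE fcycle_cyc.
by have := sub y yc; rewrite inE; apply/negP/dis.
Qed.

End CycleTypes.

Lemma cyc_exp_size {T : finType} (c : seq T) x : uniq c -> x \in c ->
  (cyc c ^+ size c)%g x = x.
Proof.
move=> uc xc; have [Q [uQ _ _ sQ pQ]] := rot_cyc uc xc.
have e := fpath_iter pQ; have : nth x (x :: rcons Q x) (size Q).+1 = x.
  by rewrite -rcons_cons nth_rcons ltnn eqxx.
rewrite e (nth_map 0) ?size_iota ?size_rcons // nth_iota ?size_rcons //.
by rewrite -sQ add0n.
Qed.

Lemma hurwitz_equiv_refl d r (s : r.-tuple 'S_d) : hurwitz_equiv s s.
Proof. by apply/existsP; exists 1%g; apply/forallP => i; rewrite conjg1. Qed.

Lemma hurwitz_equiv_sym d r (s t : r.-tuple 'S_d) : hurwitz_equiv s t = hurwitz_equiv t s.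
Proof.
by apply/existsP/existsP => -[g /forallP h]; exists g^-1%g; apply/forallP => i;
  rewrite (eqP (h i)) conjgK.
Qed.

Lemma hurwitz_equiv_trans d r (t s u : r.-tuple 'S_d) :
  hurwitz_equiv s t -> hurwitz_equiv t u -> hurwitz_equiv s u.
Proof.
move=> /existsP[g /forallP h] /existsP[g' /forallP h']; apply/existsP; exists (g * g')%g.
by apply/forallP => i; rewrite conjgM -(eqP (h i)) (eqP (h' i)).
Qed.

(** * Classification for increasing cycle lengths *)

Section Classification.

Context {d e1 e2 e3 e4 : nat}.
Hypotheses (n1 : 1 < e1) (n2 : 1 < e2) (n3 : 1 < e3) (n4 : 1 < e4).
Hypotheses (e12 : e1 <= e2) (e23 : e2 <= e3) (e34 : e3 <= e4) (e4d : e4 <= d).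
Hypothesis sum : e1 + e2 + (e3 + e4) = 2 * d + 2.

Let d0 : 0 < d. Proof. by lia. Qed.
Let big : d < e3 + e4. Proof. by lia. Qed.
Let e1_0 : 0 < e1. Proof. by lia. Qed.

Implicit Types (k m : nat) (l : 'I_d) (s : 'S_d).

Lemma factorization_single_spec k l : admissible_single e2 e3 e4 k l ->
  let s := factorization_single e1 e3 e4 k l in
  let s3s4 := compp (nth 1%g s 2) (nth 1%g s 3) in
  [/\ hurwitz_factorization [tuple e1; e2; e3; e4] s,
      trivial_or_single_cycle s3s4,
      s3s4 = sigma d e3 e4 k
    & (sigma d e3 e4 k ^- (e3 + e4 + 1 - 2 * k))%g l = l].
Proof.
move=> adm; have [R [p [A [B [R2 [A2 [B2 [sc full]]]]]]]] :=
  single_config_admissible e1_0 e12 e34 e4d big sum adm.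
have [-> ->] := single_canonical sc full; rewrite /=.
have u : uniq (R ++ p :: A ++ B) by case: sc => u *; clear -u; uniq_by_count.
have up : uniq (p :: A ++ B) by clear -u; uniq_by_count.
have lp : l \in p :: A ++ B by rewrite -(sc_mem sc) mem_head.
rewrite compp_cyc_single //; split=> //.
- exact/hurwitz4P/(single_hurwitz4 sc).
- case: (leqP 2 (size (p :: A ++ B))) => [n|].
    by right; exists (size (p :: A ++ B)) => //; apply/is_cycleP; exists (p :: A ++ B).
  by move=> + ; rewrite /= ltnS; case: (A ++ B) => // _; left; rewrite cyc1.
(* The last exponent in the first cycle is the length of sigma, so the run closes up at [l]. *)
have -> : e3 + e4 + 1 - 2 * k = size (p :: A ++ B).
  by rewrite (sc_e3 sc) (sc_e4 sc) /= size_cat; clear; lia.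
by rewrite -{1}(cyc_exp_size up lp) permK.
Qed.

Lemma factorization_double_spec k m : admissible_double d e1 e3 e4 k m ->
  let s := factorization_double d e1 e3 e4 k m in
  hurwitz_factorization [tuple e1; e2; e3; e4] s /\
  two_disjoint_cycles (compp (nth 1%g s 2) (nth 1%g s 3)).
Proof.
move=> adm; have [Rb [b [G1 [Ra [a [G2 [H1 [H2 [dc full]]]]]]]]] :=
  double_config_admissible e1_0 e12 e23 e34 e4d big sum adm.
rewrite (double_canonical dc full) /=; split; first exact/hurwitz4P/(double_hurwitz4 dc).
have u := dc_uniq dc; rewrite compp_cyc_double //.
exists (b :: G1 ++ H2), (a :: G2 ++ H1); split=> //.
- by rewrite /= size_cat -(dc_e2 dc).
- by rewrite /= size_cat -(dc_e1 dc).
- by clear -u; uniq_by_count.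
Qed.

Lemma single_param_inj k l k' l' :
  admissible_single e2 e3 e4 k l -> admissible_single e2 e3 e4 k' l' ->
  hurwitz_equiv (factorization_single e1 e3 e4 k l) (factorization_single e1 e3 e4 k' l') ->
  (k, l) = (k', l').
Proof.
move=> adm adm'; have [R [p [A [B [R2 [A2 [B2 [sc full]]]]]]]] :=
  single_config_admissible e1_0 e12 e34 e4d big sum adm.
have [R' [p' [A' [B' [R2' [A2' [B2' [sc' full']]]]]]]] :=
  single_config_admissible e1_0 e12 e34 e4d big sum adm'.
have [-> _] := single_canonical sc full; have [-> _] := single_canonical sc' full'.
move=> /hurwitz_equiv4P[g]; have [u1 u2 u3 u4] := sc_uniqs sc.
rewrite !cyc_conj //; repeat progress rewrite /= ?(map_cat, map_rev).
case=> q1 q2 q3 q4.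
have [ek el eR epA] := single_config_unique n1 n2 n3 n4 (single_config_map g sc) sc'
  (esym q1) (esym q2) (esym q3) (esym q4).
(* Both configurations are cut from the same enumeration, and the blocks before and within have
   equal lengths; so [g] maps the block (p, A, B) identically to itself, and in particular fixes
   [l]. *)
have fixg : map g (p :: A ++ B) = p :: A ++ B.
  rewrite /= map_cat epA; apply/esym.
  have : R ++ (p :: A ++ B) ++ R2 == R' ++ (p' :: A' ++ B') ++ R2'.
    by rewrite /= -!catA full full'.
  rewrite eqseq_cat; last by rewrite -eR size_map.
  rewrite eqseq_cat; first by case/and3P=> _ /eqP.
  by have := congr1 size epA; rewrite /= !size_cat !size_map.
have lp : l \in p :: A ++ B by rewrite -(sc_mem sc) mem_head.
rewrite ek -el; congr pair; apply/esym.
have : map g (p :: A ++ B) = map id (p :: A ++ B) by rewrite map_id.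
by move/eq_in_map/(_ l lp).
Qed.

Lemma double_param_inj k m k' m' :
  admissible_double d e1 e3 e4 k m -> admissible_double d e1 e3 e4 k' m' ->
  hurwitz_equiv (factorization_double d e1 e3 e4 k m) (factorization_double d e1 e3 e4 k' m') ->
  (k, m) = (k', m').
Proof.
move=> adm adm'; have [Rb [b [G1 [Ra [a [G2 [H1 [H2 [dc full]]]]]]]]] :=
  double_config_admissible e1_0 e12 e23 e34 e4d big sum adm.
have [Rb' [b' [G1' [Ra' [a' [G2' [H1' [H2' [dc' full']]]]]]]]] :=
  double_config_admissible e1_0 e12 e23 e34 e4d big sum adm'.
rewrite (double_canonical dc full) (double_canonical dc' full').
move=> /hurwitz_equiv4P[g]; have [u1 u2 u3 u4] := dc_uniqs dc.
rewrite !cyc_conj //; repeat progress rewrite /= ?(map_cat, map_rev).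
case=> q1 q2 q3 q4.
by have [-> ->] := double_config_unique n1 n2 n3 n4 (double_config_map g dc) dc'
  (esym q1) (esym q2) (esym q3) (esym q4).
Qed.

Lemma compp34_equiv s1 s2 s3 s4 t1 t2 t3 t4 :
  hurwitz_equiv [tuple s1; s2; s3; s4] [tuple t1; t2; t3; t4] ->
  exists g : 'S_d, compp s3 s4 = (compp t3 t4 ^ g)%g.
Proof.
case/hurwitz_equiv4P => g [_ _ -> ->]; exists g^-1%g.
by rewrite -comppJ conjgK.
Qed.

Lemma tuple4P {T : Type} (s : 4.-tuple T) : exists a b c e, s = [tuple a; b; c; e].
Proof.
by case: s => [[|a [|b [|c [|e []]]]] //= s4]; exists a, b, c, e; apply: val_inj.
Qed.

(** The dichotomy is whether some point is moved by both [s1] and [s2]. The type of the product of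
    [s3] and [s4] is then read off from the normal form, being invariant under conjugation. *)
Lemma factorization_cases s1 s2 s3 s4 :
  hurwitz_factorization [tuple e1; e2; e3; e4] [tuple s1; s2; s3; s4] ->
  (trivial_or_single_cycle (compp s3 s4) /\ exists k l, admissible_single e2 e3 e4 k l /\
    hurwitz_equiv [tuple s1; s2; s3; s4] (factorization_single e1 e3 e4 k l)) \/
  (two_disjoint_cycles (compp s3 s4) /\ exists k m, admissible_double d e1 e3 e4 k m /\
    hurwitz_equiv [tuple s1; s2; s3; s4] (factorization_double d e1 e3 e4 k m)).
Proof.
move=> /(hurwitz4P _ _ _ _ _ _ _ _ d0) hw.
case: (boolP [exists j, (s1 j != j) && (s2 j != j)]) => [/existsP hj|/existsPn hj].
  have [k [l [adm eqv]]] := single_exists n1 n2 n3 n4 big sum hw hj.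
  left; split; last by exists k, l.
  have [_ + _ _] := factorization_single_spec adm; move: eqv.
  have [t1 [t2 [t3 [t4 ->]]]] := tuple4P (factorization_single e1 e3 e4 k l).
  by move=> /compp34_equiv[g ->] /=; apply: trivial_or_single_cycleJ.
have [|k [m [adm eqv]]] := double_exists n1 n2 n3 n4 big sum hw.
  by move=> j; have := hj j; rewrite negb_and !negbK.
right; split; last by exists k, m.
have [_] := factorization_double_spec adm; move: eqv.
have [t1 [t2 [t3 [t4 ->]]]] := tuple4P (factorization_double d e1 e3 e4 k m).
by move=> /compp34_equiv[g ->] /=; apply: two_disjoint_cyclesJ.
Qed.

Lemma factorization_classes_disjoint k l k' m' :
  admissible_single e2 e3 e4 k l -> admissible_double d e1 e3 e4 k' m' ->
  hurwitz_equiv (factorization_single e1 e3 e4 k l) (factorization_double d e1 e3 e4 k' m') ->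
  False.
Proof.
move=> /factorization_single_spec[_ ss _ _] /factorization_double_spec[_ dd]; move: ss dd.
have [t1 [t2 [t3 [t4 ->]]]] := tuple4P (factorization_double d e1 e3 e4 k' m').
have [u1 [u2 [u3 [u4 ->]]]] := tuple4P (factorization_single e1 e3 e4 k l).
move=> /= ss dd /compp34_equiv[g eg]; apply: (single_not_double ss).
by rewrite eg; apply: two_disjoint_cyclesJ.
Qed.

End Classification.

(** * The Hurwitz number *)

Section Classes.

Context {T T' : finType}.

Lemma card_classes (R : rel T) (F X : {set T}) :
  (forall x y, R x y = R y x) -> (forall y x z, R x y -> R y z -> R x z) -> (forall x, R x x) ->
  X \subset F -> (forall s, s \in F -> exists2 x, x \in X & R s x) ->
  {in X &, forall x y, R x y -> x = y} ->
  #|equivalence_partition R F| = #|X|.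
Proof.
move=> Rsym Rtrans Rrefl XF repr RX; rewrite /equivalence_partition.
rewrite -(card_in_imset (f := fun x => [set y in F | R x y]) (D := X)).
  apply: eq_card => B; apply/imsetP/imsetP => -[s sF ->]; last by exists s; rewrite ?(subsetP XF).
  have [x xX sx] := repr s sF; exists x => //; apply/setP => y; rewrite !inE.
  case: (y \in F) => //=; apply/idP/idP; last exact: Rtrans.
  by apply: Rtrans; rewrite Rsym.
move=> x y xX yX /setP/(_ y); rewrite !inE (subsetP XF) //= Rrefl => Rxy.
exact: RX.
Qed.

(** Taking preimages under [f] within [F] reaches every class of [R] from some class of [R'], so
    there are at most as many of the former. *)
Lemma leq_card_classes (R : rel T) (R' : rel T') (F : {set T}) (F' : {set T'}) (f : T -> T') :
  {in F, forall s, f s \in F'} -> {in F &, forall s t, R' (f s) (f t) = R s t} ->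
  #|equivalence_partition R F| <= #|equivalence_partition R' F'|.
Proof.
move=> fF fR; rewrite /equivalence_partition.
apply: leq_trans (leq_imset_card (fun B : {set T'} => [set y in F | f y \in B]) _).
apply: subset_leq_card; apply/subsetP => _ /imsetP[s sF ->]; apply/imsetP.
exists [set y in F' | R' (f s) y]; first by apply/imsetP; exists (f s); rewrite ?fF.
by apply/setP => y; rewrite !inE; case: (boolP (y \in F)) => //= yF; rewrite fF ?fR.
Qed.

End Classes.

Lemma closed_perm {T : finType} (s : {perm T}) (S : {set T}) :
  (forall x, x \in S -> s x \in S) -> forall x, (s x \in S) = (x \in S).
Proof.
move=> h x; have e : s @: S = S.
  apply/eqP; rewrite eqEcard card_imset ?leqnn ?andbT; last exact: perm_inj.
  by apply/subsetP => _ /imsetP[y yS ->]; apply: h.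
by rewrite -{1}e mem_imset //; apply: perm_inj.
Qed.

(** * Symmetry of the Hurwitz number in the cycle lengths *)

Section Symmetry.

Context {d : nat}.
Hypothesis d0 : 0 < d.

Let nth4 (s : 4.-tuple 'S_d) i := nth 1%g s i.

Lemma is_cycleJ n (s g : 'S_d) : is_cycle n s -> is_cycle n (s ^ g)%g.
Proof.
case/is_cycleP => c [uc sc ->]; apply/is_cycleP; exists (map g c); rewrite size_map cyc_conj //.
by rewrite map_inj_uniq //; apply: perm_inj.
Qed.

Lemma leq_hurwitz_number (e e' : 4.-tuple nat) (f : 'S_d -> 'S_d -> 'S_d -> 'S_d -> 4.-tuple 'S_d) :
  (forall s1 s2 s3 s4, hurwitz_factorization e [tuple s1; s2; s3; s4] ->
     hurwitz_factorization e' (f s1 s2 s3 s4)) ->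
  (forall s1 s2 s3 s4 t1 t2 t3 t4, hurwitz_equiv (f s1 s2 s3 s4) (f t1 t2 t3 t4)
     = hurwitz_equiv [tuple s1; s2; s3; s4] [tuple t1; t2; t3; t4]) ->
  hurwitz_number d e <= hurwitz_number d e'.
Proof.
move=> fF fR.
apply: (leq_card_classes (f := fun s => f (nth4 s 0) (nth4 s 1) (nth4 s 2) (nth4 s 3))).
  move=> s; rewrite !inE; have [s1 [s2 [s3 [s4 ->]]]] := tuple4P s; exact: fF.
move=> s t _ _; have [s1 [s2 [s3 [s4 ->]]]] := tuple4P s.
have [t1 [t2 [t3 [t4 ->]]]] := tuple4P t; exact: fR.
Qed.

(** A braid move: as [compp] composes from right to left, [s2 ^ s1] followed on its right by [s1]
    has the same product as [s1], [s2]. It commutes with simultaneous conjugation. *)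
Lemma hurwitz_number_swap e1 e2 e3 e4 :
  hurwitz_number d [tuple e1; e2; e3; e4] <= hurwitz_number d [tuple e2; e1; e3; e4].
Proof.
apply: (leq_hurwitz_number (f := fun s1 s2 s3 s4 => [tuple (s2 ^ s1)%g; s1; s3; s4])).
  move=> s1 s2 s3 s4 /(hurwitz4P _ _ _ _ _ _ _ _ d0)[/is_cycleP c1 /is_cycleP c2 c3 c4 pr tr].
  apply/hurwitz4P => //; split=> //; [exact/is_cycleP/is_cycleJ|exact/is_cycleP| |].
    by rewrite -[RHS]pr /compp; congr mulg; rewrite conjgE !mulgA mulgV mul1g.
  move=> S S0 h21 h1 h3 h4; apply: tr => // x xS.
  (* Since [s1] permutes [S], it suffices that [s1 (s2 x)], which is [s2 ^ s1] applied to [s1 x],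
     lies in [S]. *)
  by rewrite -(closed_perm h1) -permJ h21 // h1.
move=> s1 s2 s3 s4 t1 t2 t3 t4; apply/hurwitz_equiv4P/hurwitz_equiv4P => -[g [e21 e_1 -> ->]].
  by exists g; split=> //; apply: (@conjg_inj _ t1); rewrite e21 e_1 conjJg.
by exists g; split; rewrite // ?e21 ?e_1 (conjJg s2 s1).
Qed.

Lemma hurwitz_number_rot e1 e2 e3 e4 :
  hurwitz_number d [tuple e1; e2; e3; e4] <= hurwitz_number d [tuple e2; e3; e4; e1].
Proof.
apply: (leq_hurwitz_number (f := fun s1 s2 s3 s4 => [tuple s2; s3; s4; s1])).
  move=> s1 s2 s3 s4 /(hurwitz4P _ _ _ _ _ _ _ _ d0)[c1 c2 c3 c4 pr tr].
  apply/hurwitz4P => //; split=> //; last by move=> S S0 h2 h3 h4 h1; apply: tr.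
  apply: (@conjg_inj _ s1); rewrite conj1g -pr /compp conjgE.
  by rewrite !mulgA mulVg mul1g -!mulgA.
by move=> s1 s2 s3 s4 t1 t2 t3 t4; apply/hurwitz_equiv4P/hurwitz_equiv4P => -[g [-> -> -> ->]];
  exists g.
Qed.

Lemma hurwitz_number_rotE e1 e2 e3 e4 :
  hurwitz_number d [tuple e1; e2; e3; e4] = hurwitz_number d [tuple e2; e3; e4; e1].
Proof.
apply/eqP; rewrite eqn_leq hurwitz_number_rot /=.
(* Three more rotations bring the tuple back, which gives the reverse inequality. *)
by do 3!apply: leq_trans (hurwitz_number_rot _ _ _ _) _.
Qed.

Lemma hurwitz_number_swap12 e1 e2 e3 e4 :
  hurwitz_number d [tuple e1; e2; e3; e4] = hurwitz_number d [tuple e2; e1; e3; e4].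
Proof. by apply/eqP; rewrite eqn_leq !hurwitz_number_swap. Qed.

Lemma hurwitz_number_swap23 e1 e2 e3 e4 :
  hurwitz_number d [tuple e1; e2; e3; e4] = hurwitz_number d [tuple e1; e3; e2; e4].
Proof.
by rewrite hurwitz_number_rotE hurwitz_number_swap12 -hurwitz_number_rotE.
Qed.

Lemma hurwitz_number_swap34 e1 e2 e3 e4 :
  hurwitz_number d [tuple e1; e2; e3; e4] = hurwitz_number d [tuple e1; e2; e4; e3].
Proof.
by rewrite hurwitz_number_rotE hurwitz_number_swap23 -hurwitz_number_rotE.
Qed.

End Symmetry.

(** Insertion sort by adjacent transpositions, from the right end of the tuple to the left. *)
Lemma sort4 (P : nat -> nat -> nat -> nat -> Prop) :
  (forall a b c e, P a b c e -> P b a c e) -> (forall a b c e, P a b c e -> P a c b e) ->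
  (forall a b c e, P a b c e -> P a b e c) ->
  (forall a b c e, a <= b -> b <= c -> c <= e -> P a b c e) -> forall a b c e, P a b c e.
Proof.
move=> s12 s23 s34 srt.
have step1 a b c e : b <= c -> c <= e -> P a b c e.
  move=> bc ce; case: (leqP a b) => ab; first exact: srt.
  apply: s12; case: (leqP a c) => ac; first by apply: srt => //; apply: ltnW.
  apply: s23; case: (leqP a e) => ae; first by apply: srt => //; apply: ltnW.
  by apply: s34; apply: srt => //; apply: ltnW.
have step2 a b c e : c <= e -> P a b c e.
  move=> ce; case: (leqP b c) => bc; first exact: step1.
  apply: s23; case: (leqP b e) => be; first by apply: step1 => //; apply: ltnW.
  by apply: s34; apply: step1 => //; apply: ltnW.
move=> a b c e; case: (leqP c e) => ce; first exact: step2.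
by apply: s34; apply: step2; apply: ltnW.
Qed.

Lemma card_interval n a b : b < n -> #|[set k : 'I_n | a <= k <= b]| = b.+1 - a.
Proof.
move=> bn; rewrite -subSS -(@size_asc n) // -(card_uniqP (asc_uniq _ _)).
by apply: eq_card => k; rewrite mem_asc inE !ltnS.
Qed.

(** The arithmetic series equals n (S + 1 - 2 lo - n), stated additively to avoid truncation; the
    hypothesis keeps the summands untruncated. *)
Lemma sum_arith lo n S : 2 * (lo + n) <= S + 1 ->
  \sum_(lo <= k < lo + n) (S - 2 * k) + n * (2 * lo + n) = n * (S + 1).
Proof.
elim: n => [|n IH] h; first by rewrite addn0 big_geq.
have h' : 2 * (lo + n) <= S + 1 by lia.
rewrite addnS big_nat_recr ?leq_addr //=; have := IH h'.
move: (\sum_(_ <= _ < _) _) => X e; have [y hy] : exists y, y + 2 * (lo + n) = S.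
  by exists (S - 2 * (lo + n)); lia.
have -> : S - 2 * (lo + n) = y by lia.
by nia.
Qed.

(** * Counting the admissible parameters *)

Section Count.

Context {d e1 e2 e3 e4 : nat}.
Hypotheses (n1 : 1 < e1) (n2 : 1 < e2) (n3 : 1 < e3) (n4 : 1 < e4).
Hypotheses (e12 : e1 <= e2) (e23 : e2 <= e3) (e34 : e3 <= e4) (e4d : e4 <= d).
Hypothesis sum : e1 + e2 + (e3 + e4) = 2 * d + 2.

Let A1 := [set p : 'I_d.+1 * 'I_d | admissible_single e2 e3 e4 p.1 p.2].
Let A2 := [set p : 'I_d.+1 * 'I_d.+1 | admissible_double d e1 e3 e4 p.1 p.2].

Let d0 : 0 < d. Proof. by lia. Qed.

Lemma hurwitz_number_params : hurwitz_number d [tuple e1; e2; e3; e4] = #|A1| + #|A2|.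
Proof.
pose f1 (p : 'I_d.+1 * 'I_d) := factorization_single e1 e3 e4 p.1 p.2.
pose f2 (p : 'I_d.+1 * 'I_d.+1) := factorization_double d e1 e3 e4 p.1 p.2.
have f1_inj : {in A1 &, forall p q, hurwitz_equiv (f1 p) (f1 q) -> p = q}.
  move=> [k l] [k' l']; rewrite !inE /f1 /= => ad ad' /single_param_inj h.
  by case: (h _ n1 n2 n3 n4 e12 e23 e34 e4d sum ad ad') => /val_inj -> ->.
have f2_inj : {in A2 &, forall p q, hurwitz_equiv (f2 p) (f2 q) -> p = q}.
  move=> [k l] [k' l']; rewrite !inE /f2 /= => ad ad' /double_param_inj h.
  by case: (h _ n1 n2 n3 n4 e12 e23 e34 e4d sum ad ad') => /val_inj -> /val_inj ->.
have f12 p q : p \in A1 -> q \in A2 -> hurwitz_equiv (f1 p) (f2 q) -> False.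
  rewrite !inE /f1 /f2 => ad ad'.
  have := factorization_classes_disjoint n1 n2 n3 n4 e12 e23 e34 e4d sum ad ad'; exact.
have f1_adm p : p \in A1 -> hurwitz_factorization [tuple e1; e2; e3; e4] (f1 p).
  by rewrite inE => /(factorization_single_spec n1 n2 n3 n4 e12 e23 e34 e4d sum)[].
have f2_adm p : p \in A2 -> hurwitz_factorization [tuple e1; e2; e3; e4] (f2 p).
  by rewrite inE => /(factorization_double_spec n1 n2 n3 n4 e12 e23 e34 e4d sum)[].
rewrite /hurwitz_number (@card_classes _ _ _ (f1 @: A1 :|: f2 @: A2)).
- rewrite cardsU disjoint_setI0 ?cards0 ?subn0.
    rewrite !card_in_imset // => p q pA qA e; [apply: f2_inj|apply: f1_inj] => //;
      by rewrite e hurwitz_equiv_refl.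
  rewrite disjoint_subset; apply/subsetP => _ /imsetP[p pA ->]; rewrite inE.
  by apply/imsetP => -[q qA e]; apply: (f12 p q) => //; rewrite e hurwitz_equiv_refl.
- by move=> s t; rewrite hurwitz_equiv_sym.
- by move=> t s u; apply: hurwitz_equiv_trans.
- exact: hurwitz_equiv_refl.
- by apply/subsetP => s; rewrite inE => /orP[]/imsetP[p pA ->]; rewrite inE; auto.
- move=> s; rewrite inE; have [s1 [s2 [s3 [s4 ->]]]] := tuple4P s.
  case/(factorization_cases n1 n2 n3 n4 e12 e23 e34 e4d sum) => -[_ [k [l [adm eqv]]]].
    have kd : k < d.+1 by case/and3P: (adm) => /andP[_ k3] _ _; lia.
    exists (f1 (Ordinal kd, l)) => //.
    by rewrite inE; apply/orP; left; apply/imsetP; exists (Ordinal kd, l); rewrite ?inE.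
  have kd : k < d.+1 by case/and3P: (adm) => /andP[_ k3] _ _; lia.
  have md : l < d.+1 by case/and3P: (adm) => _ _ k3; lia.
  exists (f2 (Ordinal kd, Ordinal md)) => //.
  by rewrite inE; apply/orP; right; apply/imsetP; exists (Ordinal kd, Ordinal md); rewrite ?inE.
move=> s t; rewrite !inE => /orP[]/imsetP[p pA ->] /orP[]/imsetP[q qA ->] eqv.
- by rewrite (f1_inj p q).
- by case: (f12 p q).
- by case: (f12 q p) => //; rewrite hurwitz_equiv_sym.
- by rewrite (f2_inj p q).
Qed.

Lemma card_single_params : #|A1| =
  \sum_(e3 + e4 - d <= k < (minn e3 (d + 1 - e2)).+1) (e3 + e4 + 1 - 2 * k).
Proof.
rewrite -sum1_card (eq_bigl (fun p : 'I_d.+1 * 'I_d => true && admissible_single e2 e3 e4 p.1 p.2)); last first.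
  by move=> p; rewrite inE.
rewrite -(pair_big_dep xpredT (fun (k : 'I_d.+1) l => admissible_single e2 e3 e4 k l) (fun _ _ => 1)) /=.
pose lo := e3 + e4 - d; pose hi := minn e3 (d + 1 - e2).
have hid : hi <= d by rewrite /hi; lia.
rewrite (eq_bigr (fun k : 'I_d.+1 => if lo <= k <= hi then e3 + e4 + 1 - 2 * k else 0)); last first.
  move=> k _; rewrite sum1dep_card; case: ifP => hk; last first.
    apply/eqP; rewrite cards_eq0; apply/eqP/setP => l; rewrite !inE; apply: contraFF hk.
    by case/and3P => /andP[a b] c _; rewrite /lo /hi; lia.
  rewrite (_ : _ - _ = size (asc d k (e3 + e4 - k))); last first.
    by rewrite /lo /hi in hk; rewrite size_asc; lia.
  rewrite -(card_uniqP (asc_uniq _ _)); apply: eq_card => l; rewrite mem_asc inE.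
  by rewrite /admissible_single; move: hk; rewrite /lo /hi; lia.
rewrite -big_mkcond -(big_mkord (fun k => lo <= k <= hi) (fun k => e3 + e4 + 1 - 2 * k)).
rewrite -big_filter; congr bigop; apply: (irr_sorted_eq ltn_trans ltnn).
- by apply: sorted_filter; [exact: ltn_trans|rewrite iota_ltn_sorted].
- exact: iota_ltn_sorted.
by move=> k; rewrite mem_filter !mem_index_iota; lia.
Qed.

Lemma card_double_params :
  #|A2| = (e3 + e4 - d - 1) * ((minn (d + 1 - e1) e4).+1 - (e4 - e1 + 1)).
Proof.
have -> : A2 = setX [set k : 'I_d.+1 | 1 <= k <= e3 + e4 - d - 1]
    [set m : 'I_d.+1 | e4 - e1 + 1 <= m <= minn (d + 1 - e1) e4].
  by apply/setP => -[k m]; rewrite !inE /admissible_double /= leq_min -!andbA.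
by rewrite cardsX !card_interval ?subn1 //; lia.
Qed.

(** The difference is (x - a)(N - a - x): a concave function symmetric about N / 2 is smallest at
    the ends of a symmetric interval. *)
Lemma leq_mul_reflect a x N : a <= x -> a + x <= N -> a * (N - a) <= x * (N - x).
Proof.
move=> ax axN; have [u eu] : exists u, x = a + u by exists (x - a); lia.
have [v ev] : exists v, N - x = a + v by exists (N - x - a); lia.
by rewrite ev (_ : N - a = a + u + v); [rewrite eu; nia|lia].
Qed.

Lemma hurwitz_number_sorted : hurwitz_number d [tuple e1; e2; e3; e4]
  = minn (minn (e1 * (d + 1 - e1)) (e2 * (d + 1 - e2)))
         (minn (e3 * (d + 1 - e3)) (e4 * (d + 1 - e4))).
Proof.
rewrite hurwitz_number_params card_single_params card_double_params.
have [lo elo] : exists lo, lo + d = e3 + e4 by exists (e3 + e4 - d); lia.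
have -> : e3 + e4 - d = lo by lia.
case: (leqP (e1 + e4) (d + 1)) => h14.
  (* Here d + 1 - e2 <= e3, and both [k] in case (i) and [m] in case (ii) take e1 values. The counts
     are e1 e2 and (lo - 1) e1, with e2 + lo - 1 = d + 1 - e1; the minimum is attained at e1. *)
  have -> : (minn e3 (d + 1 - e2)).+1 = lo + e1 by lia.
  have -> : (minn (d + 1 - e1) e4).+1 - (e4 - e1 + 1) = e1 by lia.
  have := @sum_arith lo e1 (e3 + e4 + 1); set X := \sum_(_ <= _ < _) _ => hX.
  have {hX} eX : X = e1 * e2.
    have {}hX : X + e1 * (2 * lo + e1) = e1 * (e3 + e4 + 2).
      by rewrite hX; [congr (_ * _)|]; lia.
    have e : e3 + e4 + 2 = e2 + (2 * lo + e1) by lia.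
    by apply: (@addIn (e1 * (2 * lo + e1))); rewrite hX e [LHS]mulnDr.
  have le i : e1 <= i -> i <= e4 -> e1 * (d + 1 - e1) <= i * (d + 1 - i).
    by move=> h h'; apply: leq_mul_reflect; lia.
  have := le e2 e12 (leq_trans e23 e34); have := le e3 (leq_trans e12 e23) e34.
  have := le e4 (leq_trans e12 (leq_trans e23 e34)) (leqnn _).
  have -> : X + (lo - 1) * e1 = e1 * (d + 1 - e1).
    by rewrite eX [RHS]mulnC mulnC -mulnDl; congr (_ * _); lia.
  by move: (e1 * _) (e2 * _) (e3 * _) (e4 * _) => x1 x2 x3 x4; clear; lia.
(* Now [k <= e3] is the binding bound, and [k] and [m] take n = d + 1 - e4 values each. The counts
   are n (d + 1 - e3) and (lo - 1) n, adding up to n e4; as n <= e1, all lengths lie between n and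
   its mirror image e4. *)
have [n en] : exists n, n + e4 = d + 1 by exists (d + 1 - e4); lia.
have -> : (minn e3 (d + 1 - e2)).+1 = lo + n by lia.
have -> : (minn (d + 1 - e1) e4).+1 - (e4 - e1 + 1) = n by lia.
have := @sum_arith lo n (e3 + e4 + 1); set X := \sum_(_ <= _ < _) _ => hX.
have [e3' ee3'] : exists e3', e3' + e3 = d + 1 by exists (d + 1 - e3); lia.
have {hX} eX : X = n * e3'.
  have {}hX : X + n * (2 * lo + n) = n * (e3 + e4 + 2).
    by rewrite hX; [congr (_ * _)|]; lia.
  have e : e3 + e4 + 2 = e3' + (2 * lo + n) by lia.
  by apply: (@addIn (n * (2 * lo + n))); rewrite hX e [LHS]mulnDr.
have e4E : e4 * (d + 1 - e4) = n * (d + 1 - n).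
  by rewrite mulnC; congr (_ * _); lia.
have le i : n <= i -> i <= e4 -> e4 * (d + 1 - e4) <= i * (d + 1 - i).
  by move=> h h'; rewrite e4E; apply: leq_mul_reflect; lia.
have n1e : n <= e1 by lia.
have := le e1 n1e (leq_trans e12 (leq_trans e23 e34)).
have := le e2 (leq_trans n1e e12) (leq_trans e23 e34).
have := le e3 (leq_trans n1e (leq_trans e12 e23)) e34.
have -> : X + (lo - 1) * n = e4 * (d + 1 - e4).
  by rewrite e4E eX mulnC -mulnDl [RHS]mulnC; congr (_ * _); lia.
by move: (e1 * _) (e2 * _) (e3 * _) (e4 * _) => x1 x2 x3 x4; clear; lia.
Qed.

End Count.

Lemma hurwitz_number_formula d e1 e2 e3 e4 :
  1 < e1 <= d -> 1 < e2 <= d -> 1 < e3 <= d -> 1 < e4 <= d ->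
  e1 + e2 + (e3 + e4) = 2 * d + 2 ->
  hurwitz_number d [tuple e1; e2; e3; e4]
  = minn (minn (e1 * (d + 1 - e1)) (e2 * (d + 1 - e2)))
         (minn (e3 * (d + 1 - e3)) (e4 * (d + 1 - e4))).
Proof.
move: e1 e2 e3 e4; apply: sort4 => e1 e2 e3 e4.
- move=> IH h1 h2 h3 h4 sum; have d0 : 0 < d by lia.
  rewrite (hurwitz_number_swap12 d0) IH //; last by lia.
  by rewrite (minnC (e2 * _)).
- move=> IH h1 h2 h3 h4 sum; have d0 : 0 < d by lia.
  rewrite (hurwitz_number_swap23 d0) IH //; last by lia.
  by rewrite minnACA.
- move=> IH h1 h2 h3 h4 sum; have d0 : 0 < d by lia.
  rewrite (hurwitz_number_swap34 d0) IH //; last by lia.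
  by rewrite (minnC (e4 * _)).
move=> e12 e23 e34 /andP[h1 _] /andP[h2 _] /andP[h3 _] /andP[h4 e4d] sum.
exact: hurwitz_number_sorted.
Qed.

Theorem theorem1p3 (d e1 e2 e3 e4 : nat) (hd : 1 <= d)
    (he1 : 2 <= e1 <= d) (he2 : 2 <= e2 <= d)
    (he3 : 2 <= e3 <= d) (he4 : 2 <= e4 <= d)
    (hsum : 2 * d - 2 = (e1 - 1) + (e2 - 1) + (e3 - 1) + (e4 - 1)) :
  hurwitz_number d [tuple e1; e2; e3; e4]
    = minn (minn (e1 * (d + 1 - e1)) (e2 * (d + 1 - e2)))
           (minn (e3 * (d + 1 - e3)) (e4 * (d + 1 - e4)))
  /\
  (e1 <= e2 <= e3 -> e3 <= e4 ->
   [/\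
     (* The two cases are exhaustive. *)
     forall s1 s2 s3 s4 : 'S_d,
       hurwitz_factorization [tuple e1; e2; e3; e4] [tuple s1; s2; s3; s4] ->
       trivial_or_single_cycle (compp s3 s4) \/ two_disjoint_cycles (compp s3 s4),
     (* Case (i): the listed tuples are Hurwitz factorizations of this kind... *)
     forall (k : nat) (l : 'I_d), admissible_single e2 e3 e4 k l ->
       let s := factorization_single e1 e3 e4 k l in
       let s3s4 := compp (nth 1%g s 2) (nth 1%g s 3) in
       [/\ hurwitz_factorization [tuple e1; e2; e3; e4] s,
           trivial_or_single_cycle s3s4,
           s3s4 = sigma d e3 e4 k
         & (sigma d e3 e4 k ^- (e3 + e4 + 1 - 2 * k))%g l = l],
     (* ... and each one of this kind is equivalent to exactly one of them. *)
     forall s1 s2 s3 s4 : 'S_d,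
       hurwitz_factorization [tuple e1; e2; e3; e4] [tuple s1; s2; s3; s4] ->
       trivial_or_single_cycle (compp s3 s4) ->
       exists! p : nat * 'I_d,
         admissible_single e2 e3 e4 p.1 p.2 /\
         hurwitz_equiv [tuple s1; s2; s3; s4]
                       (factorization_single e1 e3 e4 p.1 p.2),
     (* Case (ii), likewise. *)
     forall k m : nat, admissible_double d e1 e3 e4 k m ->
       let s := factorization_double d e1 e3 e4 k m in
       hurwitz_factorization [tuple e1; e2; e3; e4] s /\
       two_disjoint_cycles (compp (nth 1%g s 2) (nth 1%g s 3))
   & forall s1 s2 s3 s4 : 'S_d,
       hurwitz_factorization [tuple e1; e2; e3; e4] [tuple s1; s2; s3; s4] ->
       two_disjoint_cycles (compp s3 s4) ->
       exists! p : nat * nat,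
         admissible_double d e1 e3 e4 p.1 p.2 /\
         hurwitz_equiv [tuple s1; s2; s3; s4]
                       (factorization_double d e1 e3 e4 p.1 p.2)]).
Proof.
have sum : e1 + e2 + (e3 + e4) = 2 * d + 2 by lia.
split; first exact: hurwitz_number_formula.
move=> /andP[e12 e23] e34; case/andP: he1 he2 he3 he4 => [n1 _] /andP[n2 _] /andP[n3 _] /andP[n4 e4d].
have cases := factorization_cases n1 n2 n3 n4 e12 e23 e34 e4d sum.
split.
- by move=> s1 s2 s3 s4 /cases[[]|[]]; [left|right].
- exact: factorization_single_spec.
(* A normal form of the other family would make the product a pair of disjoint cycles, which the
   assumed type excludes. *)
- move=> s1 s2 s3 s4 /cases[[_ [k [l [adm eqv]]]]|[dd _] ss]; last by case: (single_not_double ss dd).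
  move=> _; exists (k, l); split=> // -[k' l'] /= [adm' eqv'].
  apply: (single_param_inj n1 n2 n3 n4 e12 e23 e34 e4d sum adm adm').
  by apply: hurwitz_equiv_trans eqv'; rewrite hurwitz_equiv_sym.
- exact: factorization_double_spec.
move=> s1 s2 s3 s4 /cases[[ss _] dd|[_ [k [m [adm eqv]]]]]; first by case: (single_not_double ss dd).
move=> _; exists (k, m); split=> // -[k' m'] /= [adm' eqv'].
apply: (double_param_inj n1 n2 n3 n4 e12 e23 e34 e4d sum adm adm').
by apply: hurwitz_equiv_trans eqv'; rewrite hurwitz_equiv_sym.
Qed.
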